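(* Let $\mu,\nu$ be probability measures on $\mathbb{R}$ with finite first moments, both absolutely continuous with respect to Lebesgue measure. Let $\theta$ be a strictly convex cost function. Assume there is a coupling of $\mu$ and $\nu$ for which the weak transport cost is finite. Then $$\overline{\mathcal{T}}_\theta(\nu|\mu)=\mathcal{T}_\theta(\mu,\nu)$$ holds if and only if the function $u\mapsto F_\mu^{-1}(u)-F_\nu^{-1}(u)$ is non-decreasing on $(0,1)$.
   Context: A cost function is an even convex function $\theta:\mathbb{R}\to[0,\infty)$ with $\theta(0)=0$. For probability measures $\mu,\nu$ with finite first moments: - The weak transport cost is $\overline{\mathcal{T}}_\theta(\nu|\mu)=\inf_\pi\int\theta\big(|x-\int y\,p(x,dy)|\big)\,\mu(dx)$. The infimum runs over all couplings $\pi(dx\,dy)=\mu(dx)p(x,dy)$ of $\mu$ (first marginal) and $\nu$ (second marginal), where $p$ is the disintegration kernel with respect to the first marginal. - The classical transport cost is $\mathcal{T}_\theta(\mu,\nu)=\inf_\pi\int\theta(|x-y|)\,d\pi(x,y)$. $F_\mu(x)=\mu((-\infty,x])$ is the cumulative distribution function, and $F_\mu^{-1}(u)=\inf\{x\in\mathbb{R}: F_\mu(x)\ge u\}$ is its generalized inverse. *)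

(* Defs.v *)
From HB Require Import structures.
From mathcomp Require Import all_boot all_order all_algebra.
From mathcomp Require Import all_classical all_reals all_analysis.
Set Implicit Arguments. Unset Strict Implicit. Unset Printing Implicit Defensive.
Import Order.TTheory GRing.Theory Num.Theory.
Import numFieldNormedType.Exports.
Local Open Scope classical_set_scope.
Local Open Scope ring_scope.

Section Defs.
Variable R : realType.

Definition cost_function (theta : R -> R) : Prop :=
  [/\ (forall x, 0 <= theta x),
      theta 0 = 0,
      (forall x, theta (- x) = theta x) &
      (forall x y t, 0 <= t <= 1 ->
         theta (t * x + (1 - t) * y) <= t * theta x + (1 - t) * theta y)].

Definition strictly_convex (theta : R -> R) : Prop :=
  forall x y t, x != y -> 0 < t < 1 ->
    theta (t * x + (1 - t) * y) < t * theta x + (1 - t) * theta y.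

Definition finite_first_moment (mu : probability R R) : Prop :=
  (\int[mu]_x (`|x|%:E) < +oo)%E.

(* A coupling pi(dx dy) = mu(dx) p(x,dy) of mu (first marginal) and nu
   (second marginal), given through its disintegration kernel p w.r.t. the
   first marginal. *)
Definition coupling_kernel (mu nu : probability R R) (p : R.-pker R ~> R) : Prop :=
  forall B, measurable B -> (\int[mu]_x (p x B) = nu B)%E.

Definition bary (p : R.-pker R ~> R) (x : R) : R := fine (\int[p x]_y (y%:E))%E.

Definition weak_cost_of (theta : R -> R) (mu : probability R R)
  (p : R.-pker R ~> R) : \bar R :=
  (\int[mu]_x (theta `|x - bary p x|)%:E)%E.

Definition classical_cost_of (theta : R -> R) (mu : probability R R)
  (p : R.-pker R ~> R) : \bar R :=
  (\int[mu]_x \int[p x]_y (theta `|x - y|)%:E)%E.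

Definition weak_transport_cost (theta : R -> R) (mu nu : probability R R) : \bar R :=
  ereal_inf [set c | exists p, coupling_kernel mu nu p /\ c = weak_cost_of theta mu p].

Definition transport_cost (theta : R -> R) (mu nu : probability R R) : \bar R :=
  ereal_inf [set c | exists p, coupling_kernel mu nu p /\ c = classical_cost_of theta mu p].

Definition cdf (mu : probability R R) (x : R) : R := fine (mu [set` `]-oo, x]]).

Definition cdf_inv (mu : probability R R) (u : R) : R :=
  inf [set x | u <= cdf mu x].

End Defs.

(* Main.v *)
Require Import Defs.
From HB Require Import structures.
From mathcomp Require Import all_boot all_order all_algebra.
From mathcomp Require Import all_classical all_reals all_analysis.
From mathcomp Require Import measurable_realfun lra ring.
Import Order.TTheory GRing.Theory Num.Theory.
Import numFieldNormedType.Exports.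
Local Open Scope classical_set_scope.
Local Open Scope ring_scope.
Set Implicit Arguments. Unset Strict Implicit. Unset Printing Implicit Defensive.

(* Let q_mu, q_nu be the quantile functions, seen as random variables on ]0, 1[
   with the uniform law, and D = q_mu - q_nu.

   A cost is a limit from below of nonnegative combinations of the hinges
   (|z| - c)^+, so E theta(Z) <= E theta(Z') follows from the comparison of
   E (Z - c)^+ with E (Z' - c)^+ and of E (- Z - c)^+ with E (- Z' - c)^+.

   Classical cost: for any coupling (X, Y), Tonelli turns E (X - Y - c)^+ into
   the integral over s of P(Y + c <= s < X), which is at least
   (F_nu (s - c) - F_mu s)^+, with equality for (q_mu, q_nu).  Hence the classical
   cost is always E theta(D), attained by the map q_nu o F_mu, whose weak cost
   is the same; so the weak cost is at most E theta(D).

   If D is nondecreasing, {D > c} is an upper set, and there is t such that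
   q_nu >= t on it and q_nu <= t off it.  With b the barycenter map of a coupling
   this gives (q_mu - b - c)^+ + (b - t)^+ >= (D - c)^+ + (q_nu - t)^+ pointwise,
   while E (b - t)^+ <= E (q_nu - t)^+ by Jensen; so every weak cost is at least
   E theta(D).

   If D(u0) > D(v0) with u0 < v0, a small fraction of the mass sent near q_nu(u0)
   is exchanged with the mass sent near q_nu(v0).  This moves the values of D
   around u0 and v0 towards each other while keeping their sum, and strict
   convexity makes the weak cost strictly smaller than E theta(D). *)

(* The [cdf] of [all_analysis] shadows the one of [Defs]. *)
Local Notation cdf := Defs.cdf.
Local Notation pos x := (Num.max x 0).

(** * Hinge approximation of costs from below *)

Section cost_functions.
Context {R : realType} (theta : R -> R).
Hypothesis cost : cost_function theta.
Implicit Types (x y z h : R) (N : nat).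

Let theta_ge0 x : 0 <= theta x. Proof. by have [] := cost. Qed.
Let theta0 : theta 0 = 0. Proof. by have [] := cost. Qed.
Let thetaN x : theta (- x) = theta x. Proof. by have [] := cost. Qed.
Let theta_convex x y t : 0 <= t <= 1 ->
  theta (t * x + (1 - t) * y) <= t * theta x + (1 - t) * theta y.
Proof. by have [_ _ _] := cost; exact. Qed.

Lemma cost_norm x : theta `|x| = theta x.
Proof. by case: (ger0P x); rewrite ?thetaN. Qed.

(** Convexity at [b], a combination of [a] and [c], with the denominator [c - a] cleared: the
    degenerate case [a = c] is covered and linear arithmetic can use the result. *)
Lemma cost_three_points a b c : a <= b -> b <= c ->
  (c - a) * theta b <= (b - a) * theta c + (c - b) * theta a.
Proof.
move=> ab bc; have [ac|ac] := eqVneq a c.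
  by have -> : b = a by [lra]; subst c; rewrite !subrr !mul0r addr0.
have ca0 : 0 < c - a by rewrite subr_gt0 lt_neqAle ac (le_trans ab).
have t01 : 0 <= (b - a) / (c - a) <= 1.
  by rewrite ler_pdivlMr// mul0r ler_pdivrMr// mul1r; apply/andP; split; lra.
have := theta_convex c a t01.
have -> : (b - a) / (c - a) * c + (1 - (b - a) / (c - a)) * a = b.
  by field; rewrite gt_eqF.
rewrite -(ler_pM2l ca0) => /le_trans; apply.
by rewrite le_eqVlt; apply/orP; left; apply/eqP; field; rewrite ?gt_eqF.
Qed.

Lemma cost_le x y : 0 <= x -> x <= y -> theta x <= theta y.
Proof.
move=> x0 xy; have := cost_three_points x0 xy.
rewrite theta0 mulr0 addr0 !subr0 => h.
have [y0|y0] := eqVneq y 0.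
  by have -> : x = y by [lra]; [].
have {}y0 : 0 < y by rewrite lt_neqAle eq_sym y0 (le_trans x0).
rewrite -(ler_pM2l y0) (le_trans h)// ler_wpM2r//.
Qed.

(** The slope of [theta] to the left of [z] is at most its slope on [[z, z + 1]]. This is a
    quantitative left continuity, with a rate independent of [e]. *)
Lemma cost_ge_left z e : 0 <= e ->
  theta z - e * (theta (z + 1) - theta z) <= theta (z - e).
Proof.
move=> e0; have := @cost_three_points (z - e) z (z + 1) ltac:(lra) ltac:(lra).
by lra.
Qed.

Lemma measurable_cost : measurable_fun [set: R] theta.
Proof.
(* Flattened to the left of [0], [theta] is nondecreasing on the whole line, hence measurable. *)
have -> : theta = (fun z => theta (Num.max z 0)) \o Num.norm.
  by apply/funext => x /=; rewrite max_l ?cost_norm.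
apply: measurableT_comp => //.
apply: nondecreasing_measurable => // x y xy; apply: cost_le.
  by rewrite le_max lexx orbT.
by rewrite ge_max !le_max xy lexx !orbT.
Qed.

(* For [k = 0] the cell is degenerate ([k.-1 = 0]) and its slope is [0]. *)
Definition cell_slope h k : R := (theta (k%:R * h) - theta (k.-1%:R * h)) / h.

(** On [z >= 0], the piecewise linear interpolation of [theta] at the multiples of [h], shifted
    right by one step and continued affinely after [N%:R * h]. Unshifted it would lie above [theta];
    the shift brings it below. *)
Definition hinge_sum h N z : R :=
  \sum_(k < N) (cell_slope h k.+1 - cell_slope h k) *
    Num.max (z - k.+1%:R * h) 0.

Lemma cell_slope_ge0 h k : 0 < h -> 0 <= cell_slope h k.
Proof.
move=> h0; rewrite /cell_slope divr_ge0 ?(ltW h0)// subr_ge0 cost_le//.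
  by rewrite mulr_ge0// ltW.
by rewrite ler_wpM2r// ?(ltW h0)// ler_nat leq_pred.
Qed.

Lemma cell_slope_le h k : 0 < h -> cell_slope h k <= cell_slope h k.+1.
Proof.
move=> h0; rewrite /cell_slope ler_pM2r ?invr_gt0//=.
case: k => [|k] /=.
  by rewrite mul0r subrr theta0 subr0 theta_ge0.
rewrite -(ler_pM2l h0) -[k.+2%:R]natr1 -[k.+1%:R]natr1.
have := @cost_three_points (k%:R * h) ((k%:R + 1) * h) ((k%:R + 1 + 1) * h)
  ltac:(lra) ltac:(lra).
by lra.
Qed.

(** Past the last node every hinge is active and the slopes telescope. The predecessor [N.-1] is the
    effect of the shift. *)
Lemma hinge_sumE h N z : 0 < h -> N%:R * h <= z ->
  hinge_sum h N z = theta (N.-1%:R * h) + cell_slope h N * (z - N%:R * h).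
Proof.
move=> h0; elim: N => [|N IH] Nz.
  rewrite /hinge_sum big_ord0 /cell_slope /= !mul0r theta0 subrr !mul0r.
  by rewrite addr0.
rewrite /hinge_sum big_ord_recr/= -/(hinge_sum h N z) IH; last first.
  by move: Nz; rewrite -natr1; lra.
rewrite max_l ?subr_ge0//.
have -> : theta (N%:R * h) = theta (N.-1%:R * h) + cell_slope h N * h.
  by rewrite /cell_slope; field; rewrite gt_eqF.
by rewrite -natr1; ring.
Qed.

Lemma hinge_sum_last0 h N z : z <= N.+1%:R * h ->
  hinge_sum h N.+1 z = hinge_sum h N z.
Proof.
by move=> zN; rewrite /hinge_sum big_ord_recr/= max_r ?mulr0 ?addr0// subr_le0.
Qed.

(** Past the last node the sum is affine, with the slope of the last chord; convexity keeps [theta]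
    above the continuation of that chord. Before it, the last hinge vanishes and induction
    applies. *)
Lemma hinge_sum_le h N z : 0 < h -> 0 <= z -> hinge_sum h N z <= theta z.
Proof.
move=> h0 z0; elim: N => [|N IH]; first by rewrite /hinge_sum big_ord0.
have [zN|zN] := ltP z (N.+1%:R * h); first by rewrite hinge_sum_last0// ltW.
rewrite hinge_sumE// /= -(ler_pM2l h0) mulrDr.
have -> : h * (cell_slope h N.+1 * (z - N.+1%:R * h)) =
    (theta (N.+1%:R * h) - theta (N%:R * h)) * (z - N.+1%:R * h).
  by rewrite /cell_slope/=; field; rewrite gt_eqF.
have le1 : theta (N%:R * h) <= theta (N.+1%:R * h).
  by rewrite cost_le ?mulr_ge0 ?(ltW h0)// ler_wpM2r ?(ltW h0)// ler_nat.
have := @cost_three_points (N%:R * h) (N.+1%:R * h) z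
  ltac:(by rewrite ler_wpM2r ?(ltW h0)// ler_nat) zN.
by move: le1 zN; rewrite -natr1 => le1 zN; nra.
Qed.

(** The sum at [z] is at least the value of [theta] at a node within [2 h] to the left of [z]: one
    [h] for the shift, one for the cell containing [z]. *)
Lemma hinge_sum_ge h N z : 0 < h -> 0 <= z -> z <= N%:R * h ->
  theta z - h *+ 2 * (theta (z + 1) - theta z) <= hinge_sum h N z.
Proof.
move=> h0 z0.
have d0 : 0 <= theta (z + 1) - theta z by rewrite subr_ge0 cost_le// lerDl.
elim: N => [|N IH] zN.
  have {zN}-> : z = 0 by move: zN; rewrite mul0r; lra.
  by rewrite /hinge_sum big_ord0 theta0 !add0r !subr0; have := theta_ge0 1; nra.
rewrite hinge_sum_last0//.
have [/IH //|/ltW Nz] := leP z (N%:R * h).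
rewrite hinge_sumE//.
have s0 := cell_slope_ge0 N h0.
have le2 : z - N.-1%:R * h <= h *+ 2.
  move: zN; rewrite -natr1; case: N {IH Nz s0} => [|N] /=; first by lra.
  by rewrite -natr1; lra.
have ge2 : 0 <= z - N.-1%:R * h.
  by rewrite subr_ge0 (le_trans _ Nz)// ler_wpM2r ?(ltW h0)// ler_nat leq_pred.
have := cost_ge_left z ge2; rewrite opprB addrCA subrr addr0.
by nra.
Qed.

Lemma hinge_sum_limn_einf z : 0 <= z ->
  limn_einf (fun n => (hinge_sum n.+1%:R^-1 (n.+1 * n.+1) z)%:E) =
  (theta z)%:E.
Proof.
move=> z0.
suff cvgz : (hinge_sum n.+1%:R^-1 (n.+1 * n.+1) z) @[n --> \oo] --> theta z.
  rewrite is_cvg_limn_einfE; last first.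
    by apply/cvg_ex; exists (theta z)%:E; apply: cvg_EFin => //; exact: nearW.
  by apply/cvg_lim => //; apply: cvg_EFin => //; exact: nearW.
have cvgl : theta z - n.+1%:R^-1 *+ 2 * (theta (z + 1) - theta z)
    @[n --> \oo] --> theta z.
  rewrite -[X in _ --> X]subr0 -[X in _ --> _ - X](mul0r (theta (z + 1) - theta z)).
  apply: cvgB; first exact: cvg_cst.
  apply: cvgM; last exact: cvg_cst.
  rewrite -[X in _ --> X](mul0rn _ 2); apply: cvgMn.
  exact: cvg_harmonic.
apply: (squeeze_cvgr _ cvgl (cvg_cst _)).
near=> n; rewrite hinge_sum_le ?invr_gt0 ?ltr0n// andbT hinge_sum_ge//.
(* With mesh [1 / n.+1], the [n.+1 * n.+1] nodes cover [[0, n.+1]], which contains [z] for large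
   [n]. *)
rewrite natrM mulfK//; near: n; exists (Num.truncn z) => // n /= nz.
by rewrite (le_trans (ltW (truncnS_gt z)))// ler_nat ltnS.
Unshelve. all: by end_near. Qed.

End cost_functions.

(** * Comparing expected costs through hinges *)

Section hinge_comparison.
Context {R : realType} (theta : R -> R).
Hypothesis cost : cost_function theta.

Lemma pos_norm (z c : R) : 0 <= c -> pos (`|z| - c) = pos (z - c) + pos (- z - c).
Proof.
move=> c0; have [z0|z0] := ger0P z.
  by rewrite (@max_r _ _ (- z - c)) ?addr0//; lra.
by rewrite (@max_r _ _ (z - c)) ?add0r//; lra.
Qed.

Lemma measurable_pos d (T : measurableType d) (f : T -> R) :
  measurable_fun [set: T] f -> measurable_fun [set: T] (fun x => pos (f x)).
Proof. by move=> mf; apply: measurable_maxr. Qed.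

Lemma measurable_hinge_sum d (T : measurableType d) h N (Z : T -> R) :
  measurable_fun [set: T] Z ->
  measurable_fun [set: T] (fun x => hinge_sum theta h N `|Z x|).
Proof.
move=> mZ; apply: measurable_sum => k; apply: measurable_funM => //.
apply: measurable_pos; apply: measurable_funB => //.
exact: measurableT_comp.
Qed.

Lemma integral_hinge_sum d (T : measurableType d)
    (m : {measure set T -> \bar R}) h N (Z : T -> R) : 0 < h ->
  measurable_fun [set: T] Z ->
  (\int[m]_x (hinge_sum theta h N `|Z x|)%:E =
   \sum_(k < N) (cell_slope theta h k.+1 - cell_slope theta h k)%:E *
     (\int[m]_x (pos (Z x - k.+1%:R * h))%:E +
      \int[m]_x (pos (- Z x - k.+1%:R * h))%:E))%E.
Proof.
move=> h0 mZ.
have mp (c : R) : measurable_fun [set: T] (fun x => (pos (Z x - c))%:E).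
  by apply/measurable_EFinP/measurable_pos; exact: measurable_funB.
have mn (c : R) : measurable_fun [set: T] (fun x => (pos (- Z x - c))%:E).
  apply/measurable_EFinP/measurable_pos; apply: measurable_funB => //.
  exact: measurableT_comp.
have p0 (x : R) : (0 <= (pos x)%:E)%E by rewrite lee_fin le_max lexx orbT.
have a0 k : 0 <= cell_slope theta h k.+1 - cell_slope theta h k.
  by rewrite subr_ge0 (cell_slope_le cost).
under eq_integral do rewrite -sumEFin.
rewrite ge0_integral_sum//; last 2 first.
- move=> k; apply/measurable_EFinP; apply: measurable_funM => //.
  apply: measurable_pos; apply: measurable_funB => //.
  exact: measurableT_comp.
- by move=> k x _; rewrite lee_fin mulr_ge0// le_max lexx orbT.
apply: eq_bigr => k _.
rewrite -ge0_integralD// -ge0_integralZl_EFin//; last 2 first.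
- by move=> x _; rewrite adde_ge0.
- exact: emeasurable_funD.
apply: eq_integral => x _; rewrite pos_norm ?EFinM ?EFinD//.
by rewrite mulr_ge0// ltW.
Qed.

(** Linearity gives the inequality for each hinge sum. On the right hinge sums stay below [theta];
    on the left Fatou's lemma passes to the limit. The two variables may live on different spaces,
    as only their laws are compared. *)
Lemma le_integral_cost d1 d2 (T1 : measurableType d1) (T2 : measurableType d2)
    (m1 : {measure set T1 -> \bar R}) (m2 : {measure set T2 -> \bar R})
    (Z1 : T1 -> R) (Z2 : T2 -> R) :
  measurable_fun [set: T1] Z1 -> measurable_fun [set: T2] Z2 ->
  (forall c, 0 <= c -> (\int[m1]_x (pos (Z1 x - c))%:E <=
                        \int[m2]_x (pos (Z2 x - c))%:E)%E) ->
  (forall c, 0 <= c -> (\int[m1]_x (pos (- Z1 x - c))%:E <=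
                        \int[m2]_x (pos (- Z2 x - c))%:E)%E) ->
  (\int[m1]_x (theta (Z1 x))%:E <= \int[m2]_x (theta (Z2 x))%:E)%E.
Proof.
move=> mZ1 mZ2 lep len.
pose h n : R := n.+1%:R^-1.
have h0 n : 0 < h n by rewrite invr_gt0.
pose S n z := hinge_sum theta (h n) (n.+1 * n.+1) z.
have S0 n z : 0 <= S n z.
  rewrite /S /hinge_sum sumr_ge0// => k _.
  by rewrite mulr_ge0 ?subr_ge0 ?(cell_slope_le cost)// le_max lexx orbT.
have leS n : (\int[m1]_x (S n `|Z1 x|)%:E <= \int[m2]_x (theta (Z2 x))%:E)%E.
  apply: (@le_trans _ _ (\int[m2]_x (S n `|Z2 x|)%:E)%E).
    rewrite !integral_hinge_sum//; apply: lee_sum => k _.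
    rewrite lee_wpmul2l// ?lee_fin ?subr_ge0 ?(cell_slope_le cost)//.
    by rewrite leeD ?lep ?len// mulr_ge0// ltW.
  apply: ge0_le_integral => //.
  - by move=> x _; rewrite lee_fin.
  - by apply/measurable_EFinP; exact: measurable_hinge_sum.
  - apply/measurable_EFinP/measurableT_comp => //.
    exact: (measurable_cost cost).
  - move=> x _; rewrite lee_fin -(cost_norm cost (Z2 x)).
    by rewrite (hinge_sum_le cost).
have -> : (\int[m1]_x (theta (Z1 x))%:E =
    \int[m1]_x limn_einf (fun n => (S n `|Z1 x|)%:E))%E.
  apply: eq_integral => x _.
  by rewrite (hinge_sum_limn_einf cost)// (cost_norm cost).
apply: le_trans (fatou _ _ _ _) _ => //.
- by move=> n; apply/measurable_EFinP; exact: measurable_hinge_sum.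
- by move=> n x _; rewrite lee_fin.
rewrite limn_einf_lim; apply: lime_le; first exact: is_cvg_einfs.
apply: nearW => n; apply: le_trans (leS n).
by apply: ereal_inf_lbound; exists n => /=.
Qed.

End hinge_comparison.

(** * The uniform law on []0, 1[] *)

Section uniform.
Context {R : realType}.

(* [lebesgue_measure] lives on [measurableTypeR R]; [leb] is the same measure
   on the measurable structure of [R] itself. *)
Definition leb : set R -> \bar R := @lebesgue_measure R.

HB.instance Definition _ := isMeasure.Build _ R R leb
  (measure0 (@lebesgue_measure R)) (measure_ge0 (@lebesgue_measure R))
  (@measure_semi_sigma_additive _ _ _ (@lebesgue_measure R)).

HB.instance Definition _ := Measure_isSigmaFinite.Build _ R R leb
  (@sigma_finiteT _ _ _ (@lebesgue_measure R)).

(** The uniform law is a measure on all of [R] that charges only []0, 1[], so that random variables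
    on it are total functions on [R]. *)
Definition unif : set R -> \bar R := mrestr leb (measurable_itv `]0%R, 1%R[).
HB.instance Definition _ := Measure.on unif.

Lemma leb_itv (a b : bool) (x y : R) :
  leb [set` Interval (BSide a x) (BSide b y)] = (pos (y - x))%:E.
Proof.
rewrite /leb lebesgue_measure_itv /= lte_fin; case: ltP => xy.
  by rewrite max_l// subr_ge0 ltW.
by rewrite max_r// subr_le0.
Qed.

Lemma unif_itv (x y : R) : 0 <= x -> y <= 1 ->
  unif `]x, y]%classic = (pos (y - x))%:E.
Proof.
move=> x0 y1; apply/eqP; rewrite eq_le; apply/andP; split.
  rewrite -(leb_itv false false x y); apply: le_measure; rewrite ?inE//.
  by apply: measurableI; exact: measurable_itv.
rewrite -(leb_itv false true x y); apply: le_measure; rewrite ?inE//.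
  by apply: measurableI; exact: measurable_itv.
move=> u /=; rewrite !in_itv/= => /andP[xu uy].
by rewrite xu (ltW uy) (le_lt_trans x0 xu) (lt_le_trans uy y1).
Qed.

Lemma unif_setT : unif [set: R] = 1%E.
Proof. by rewrite /unif /mrestr setTI leb_itv subr0 max_l. Qed.

HB.instance Definition _ := Measure_isProbability.Build _ _ _ unif unif_setT.

Lemma unif_ae (P : R -> Prop) : (forall u, 0 < u < 1 -> P u) ->
  {ae unif, forall u, P u}.
Proof.
move=> UP; exists (~` `]0, 1[%classic); split.
- by apply: measurableC; exact: measurable_itv.
- by rewrite /unif /mrestr setICl measure0.
- by move=> u /=; apply: contra_not; rewrite in_itv/=; exact: UP.
Qed.

End uniform.

(** * Distribution and quantile functions *)

Section quantile.
Context {R : realType} (mu : probability R R).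
Implicit Types (u t x y : R).

Lemma cdf_nd : {homo cdf mu : x y / x <= y}.
Proof.
move=> x y xy; rewrite /cdf fine_le ?fin_num_measure//; try exact: measurable_itv.
apply: le_measure; rewrite ?inE; [exact: measurable_itv|exact: measurable_itv|].
by move=> z /=; rewrite !in_itv/= => /le_trans; exact.
Qed.

Lemma cdf_fine_ge0 x : 0 <= cdf mu x. Proof. exact: fine_ge0. Qed.

Lemma cdf_fine_le1 x : cdf mu x <= 1.
Proof.
rewrite -lee_fin /cdf fineK ?fin_num_measure ?probability_le1//;
  exact: measurable_itv.
Qed.

(** Under [mu] the identity is a random variable with distribution function [cdf mu]; the limits and
    right continuity known for random variables thus transfer to [cdf mu]. *)
Let idR : R -> R := idfun.
#[local] HB.instance Definition _ :=
  @isMeasurableFun.Build _ _ _ _ idR (@measurable_id _ _ setT).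

Let cdfE x : (cdf mu x)%:E = random_variable.cdf (idR : {RV mu >-> R}) x.
Proof. by rewrite /cdf fineK// fin_num_measure//; exact: measurable_itv. Qed.

Lemma cdf_lt_small u : 0 < u -> exists x, cdf mu x < u.
Proof.
move=> u0; have := cvg_cdfNy0 (idR : {RV mu >-> R}).
move=> /fine_cvgP [_ /cvgrPdist_lt /(_ _ u0)] [M [_ near0]]; exists (M - 1).
have : `|0 - cdf mu (M - 1)| < u.
  by apply: (near0 (M - 1)); rewrite ltrBlDr ltrDl ltr01.
by rewrite add0r normrN ger0_norm ?cdf_fine_ge0.
Qed.

Lemma cdf_ge_large u : u < 1 -> exists x, u <= cdf mu x.
Proof.
move=> u1; have := cvg_cdfy1 (idR : {RV mu >-> R}).
have e0 : 0 < 1 - u by rewrite subr_gt0.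
move=> /fine_cvgP [_ /cvgrPdist_lt /(_ _ e0)] [M [_ near1]]; exists (M + 1).
have : `|1 - cdf mu (M + 1)| < 1 - u.
  by apply: (near1 (M + 1)); rewrite ltrDl ltr01.
by rewrite ger0_norm ?subr_ge0 ?cdf_fine_le1//; lra.
Qed.

Lemma cdf_right_lt t u : cdf mu t < u -> exists2 s, t < s & cdf mu s < u.
Proof.
move=> tu; have e0 : 0 < u - cdf mu t by rewrite subr_gt0.
have /fine_cvgP[_ /cvgrPdist_lt /(_ _ e0)] :
    random_variable.cdf (idR : {RV mu >-> R}) s @[s --> t^'+] --> (cdf mu t)%:E.
  by rewrite cdfE; exact: cdf_right_continuous.
move=> near_t; near (t^'+)%R => s; exists s.
  by near: s; exact: nbhs_right_gt.
have : `|cdf mu t - fine (random_variable.cdf (idR : {RV mu >-> R}) s)| <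
    u - cdf mu t by near: s.
by rewrite -cdfE/= ltr_norml => /andP[]; lra.
Unshelve. all: by end_near. Qed.

(** The Galois connection between quantile and distribution functions. By right continuity the
    infimum defining [cdf_inv] is attained, which gives the implication from left to right. *)
Lemma cdf_inv_le u t : 0 < u < 1 -> (cdf_inv mu u <= t) = (u <= cdf mu t).
Proof.
move=> /andP[u0 u1].
have hi : has_inf [set x | u <= cdf mu x].
  split; first by have [x ux] := cdf_ge_large u1; exists x.
  have [x xu] := cdf_lt_small u0; exists x => y /= uy.
  rewrite leNgt; apply/negP => /ltW/cdf_nd yx.
  by have := lt_le_trans xu (le_trans uy yx); rewrite ltxx.
apply/idP/idP => [|ut]; last by apply: ge_inf => //; exact: hi.2.
rewrite leNgt [u <= _]leNgt; apply: contra => /cdf_right_lt[s ts su].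
rewrite (lt_le_trans ts)// lb_le_inf//; first exact: hi.1.
move=> y /= uy; rewrite leNgt; apply/negP => /ltW/cdf_nd ys.
by have := lt_le_trans su (le_trans uy ys); rewrite ltxx.
Qed.

Lemma cdf_inv_nd u v : 0 < u -> u <= v -> v < 1 -> cdf_inv mu u <= cdf_inv mu v.
Proof.
move=> u0 uv v1.
by rewrite cdf_inv_le ?u0 ?(le_lt_trans uv)// (le_trans uv)// -cdf_inv_le ?lexx//
  v1 (lt_le_trans u0).
Qed.

(** Left continuity of the quantile function; being nondecreasing, it only needs a bound from
    below. *)
Lemma cdf_inv_left u e : 0 < u < 1 -> 0 < e ->
  exists2 w, 0 < w < u & forall v, w < v -> v <= u ->
    cdf_inv mu u - e <= cdf_inv mu v.
Proof.
move=> u01 e0; have /andP[u0 u1] := u01.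
set q := cdf_inv mu u - e.
have qu : cdf mu q < u by rewrite ltNge -cdf_inv_le// -ltNge /q; lra.
(* The bound [u / 2] keeps the witness positive when [cdf mu q = 0]. *)
exists (Num.max (cdf mu q) (u / 2)).
  rewrite gt_max lt_max qu divr_gt0// orbT/=; lra.
move=> v; rewrite gt_max => /andP[qv uv] vu.
have v01 : 0 < v < 1 by apply/andP; split; lra.
by rewrite ltW// ltNge cdf_inv_le// -ltNge.
Qed.

(** Points left of [q := cdf_inv mu u] have [cdf] below [u], so []-oo, q[] has mass at most [u] by
    continuity from below; absolute continuity excludes an atom at [q]. *)
Lemma cdf_cdf_inv u : mu `<< @lebesgue_measure R -> 0 < u < 1 ->
  cdf mu (cdf_inv mu u) = u.
Proof.
move=> mu_leb u01; apply/eqP; rewrite eq_le -cdf_inv_le// lexx andbT.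
set q := cdf_inv mu u.
have mu_q : mu [set q] = 0%E.
  apply: (mu_leb [set q] _ [set q]) => //.
  move=> A mA Aq; apply/eqP; rewrite -measure_le0 -(lebesgue_measure_set1 q).
  by apply: le_measure; rewrite ?inE//; exact: measurable_set1.
have mI (b : bool) x : measurable [set` Interval -oo%O (BSide b x)].
  exact: measurable_itv.
have le_u : (mu `]-oo, q[%classic <= u%:E)%E.
  have q_bigcup : `]-oo, q[%classic = \bigcup_n `]-oo, q - n.+1%:R^-1]%classic.
    apply/seteqP; split => [x /=|x [n _] /=]; rewrite !in_itv/=; last first.
      by move=> /le_lt_trans; apply; rewrite ltrBlDr ltrDl invr_gt0.
    move=> xq; have qx0 : 0 < q - x by rewrite subr_gt0.
    have [n _ nx] := near_infty_natSinv_lt (PosNum qx0).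
    have {}nx : n.+1%:R^-1 < q - x by exact: (nx n (leqnn n)).
    by exists n => //=; rewrite in_itv/= lerBrDl -lerBrDr ltW.
  rewrite q_bigcup.
  have : (mu \o (fun n => `]-oo, q - n.+1%:R^-1]%classic) @ \oo -->
      mu (\bigcup_n `]-oo, q - n.+1%:R^-1]%classic))%classic.
    apply: nondecreasing_cvg_mu => //; first by rewrite -q_bigcup.
    move=> m n mn; apply/subsetPset => x /=; rewrite !in_itv/= => /le_trans; apply.
    by rewrite lerB// lef_pV2 ?posrE// ler_nat.
  move=> cvgq; rewrite -(cvg_lim _ cvgq)//; apply: lime_le; first exact: cvgP cvgq.
  apply: nearW => n /=.
  rewrite -[leLHS]fineK ?fin_num_measure// lee_fin ltW//.
  by rewrite -/(cdf mu _) ltNge -cdf_inv_le// -ltNge ltrBlDr ltrDl invr_gt0.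
rewrite -lee_fin /cdf fineK ?fin_num_measure//.
rewrite (_ : [set` `]-oo, q]] = `]-oo, q[%classic `|` [set q]); last first.
  by rewrite setUitv1.
apply: le_trans (measureU2 _ _ _) _ => //.
by rewrite -[leRHS]adde0 -mu_q; apply: leeD.
Qed.

(* [quantile mu] is [0], not an extended real, outside of the unit interval. *)
Definition quantile : R -> R := cdf_inv mu \_ `]0, 1[%classic.

Lemma quantileE u : 0 < u < 1 -> quantile u = cdf_inv mu u.
Proof. by move=> u01; rewrite /quantile patchE mem_set//= in_itv. Qed.

Lemma measurable_quantile : measurable_fun [set: R] quantile.
Proof.
apply/(measurable_restrictT _ (measurable_itv `]0%R, 1%R[)).
apply: (measurability (@RGenOInfty.G R)) => [|/= _ [_] [t] -> <-].
  exact: RGenOInfty.measurableE.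
rewrite (_ : _ `&` _ = `]0, 1[%classic `&` `]cdf mu t, +oo[%classic).
  by apply: measurableI; exact: measurable_itv.
apply/seteqP; split=> u [/=]; rewrite !in_itv/= !andbT => u01.
  by rewrite ltNge cdf_inv_le// -ltNge; split; rewrite /= ?in_itv/= ?andbT.
by rewrite ltNge -cdf_inv_le// -ltNge; split; rewrite /= ?in_itv/= ?andbT.
Qed.

HB.instance Definition _ :=
  @isMeasurableFun.Build _ _ R R quantile measurable_quantile.

(** By the Galois connection, inside []0, 1[] the preimage of []-oo, t]] is []0, cdf mu t]]; such
    half-lines form a generating class stable under intersection. *)
Lemma pushforward_quantile A : measurable A -> unif (quantile @^-1` A) = mu A.
Proof.
pose G := [set `]-oo, x]%classic | x in [set: R]].
have mI x : measurable `]-oo, x]%classic by exact: measurable_itv.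
apply: (@measure_unique _ R R G (fun n => `]-oo, n%:R]%classic) _ _ _ _
    (pushforward unif quantile) mu).
- apply/seteqP; split; last first.
    apply: smallest_sub; first exact: sigma_algebra_measurable.
    by move=> _ [x _ <-].
  rewrite [X in X `<=` _](RGenOInfty.measurableE R); apply: smallest_sub.
    exact: smallest_sigma_algebra.
  move=> _ [x ->]; rewrite -setCitvl; apply: sigma_algebraC.
  by apply: sub_sigma_algebra; exists x.
- move=> _ _ [x _ <-] [y _ <-]; exists (Num.min x y) => //.
  apply/seteqP; split => z; rewrite /= !in_itv/= le_min; first by move/andP.
  by move=> [-> ->].
- by move=> n; exists n%:R.
- apply/seteqP; split => // x _; exists (Num.truncn x).+1 => //=.
  by rewrite in_itv/= ltW// truncnS_gt.
- move=> _ [t _ <-]; rewrite /pushforward.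
  transitivity (unif `]0, cdf mu t]%classic); last first.
    rewrite unif_itv ?cdf_fine_le1// subr0 max_l ?cdf_fine_ge0// /cdf fineK//.
  rewrite /unif /mrestr; congr (leb _); apply/seteqP.
  split=> u /=; rewrite /setI/= !in_itv/= => -[+ u01];
    rewrite quantileE// cdf_inv_le//; have /andP[u0 _] := u01.
  - by move=> ut; rewrite {1}u0.
  - by move=> /andP[_ ut]; split.
- move=> n; apply: (@le_lt_trans _ _ 1%E); last by rewrite ltry.
  apply: (@probability_le1 _ _ _ unif).
  by rewrite -[X in measurable X]setTI; exact: measurable_quantile.
Qed.

Lemma integral_quantile (f : R -> \bar R) : measurable_fun [set: R] f ->
  (forall x, 0 <= f x)%E ->
  (\int[mu]_x f x = \int[unif]_u f (quantile u))%E.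
Proof.
move=> mf f0.
rewrite (eq_measure_integral (pushforward unif quantile)); last first.
  by move=> A mA _; exact/esym/pushforward_quantile.
by rewrite ge0_integral_pushforward// preimage_setT.
Qed.

End quantile.

(** * The joint law of a coupling given by its kernel *)

Section joint.
Context {d d'} {X : measurableType d} {Y : measurableType d'} {R : realType}.
Local Open Scope ereal_scope.

Variable p : R.-pker X ~> Y.

(** The law of [(x, y)] with [y] drawn from [p x]. The factor [unit] is the source required by
    kernel composition, where [mu] enters as a kernel from [unit]. *)
Definition kgraph (ux : unit * X) : {measure set (X * Y) -> \bar R}.
Proof.
refine (pushforward (p ux.2) (pair ux.2)); exact: pair1_measurable.
Defined.

Let measurable_kgraph U : measurable U -> measurable_fun setT (kgraph ^~ U).
Proof.
move=> mU.
have -> : kgraph ^~ U = (fun x => p x (xsection U x)) \o snd.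
  by apply/funext => ux /=; rewrite /kgraph /pushforward xsectionE.
apply: measurableT_comp => //.
exact: (measurable_fun_xsection_finite_kernel p (mem_set mU)).
Qed.

HB.instance Definition _ := isKernel.Build _ _ _ _ _ kgraph measurable_kgraph.

Let kgraph_prob ux : kgraph ux [set: X * Y] = 1.
Proof. exact: (prob_kernel (s := p) ux.2). Qed.

HB.instance Definition _ := Kernel_isProbability.Build _ _ _ _ _
  kgraph kgraph_prob.

Variable mu : probability X R.

Definition kcst (_ : unit) : {measure set X -> \bar R} := mu.

Let measurable_kcst U : measurable U -> measurable_fun setT (kcst ^~ U).
Proof. by move=> _; exact: measurable_cst. Qed.

HB.instance Definition _ := isKernel.Build _ _ _ _ _ kcst measurable_kcst.

Let kcst_prob u : kcst u [set: X] = 1. Proof. exact: probability_setT. Qed.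

HB.instance Definition _ := Kernel_isProbability.Build _ _ _ _ _ kcst kcst_prob.

Definition joint : set (X * Y) -> \bar R := kcomp kcst kgraph tt.
HB.instance Definition _ := Measure.on joint.

Lemma integral_joint f : measurable_fun [set: X * Y] f -> (forall z, 0 <= f z) ->
  \int[joint]_z f z = \int[mu]_x \int[p x]_y f (x, y).
Proof.
move=> mf f0; rewrite /joint integral_kcomp//; apply: eq_integral => x _.
by rewrite ge0_integral_pushforward//= preimage_setT.
Qed.

Lemma jointE A : measurable A -> joint A = \int[mu]_x p x (xsection A x).
Proof.
by move=> mA; apply: eq_integral => x _; rewrite /kgraph /pushforward xsectionE.
Qed.

Lemma joint_setT : joint [set: X * Y] = 1.
Proof.
rewrite jointE//; under eq_integral do rewrite xsectionE preimage_setT prob_kernel.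
by rewrite integral_cst// mul1e; exact: probability_setT.
Qed.

HB.instance Definition _ := Measure_isProbability.Build _ _ _ joint joint_setT.

Lemma joint_fst A : measurable A -> joint (fst @^-1` A) = mu A.
Proof.
move=> mA; rewrite jointE; last first.
  by rewrite -[X in measurable X]setTI; exact: measurable_fst.
rewrite -[A in RHS]setIT -integral_indic//; apply: eq_integral => x _.
rewrite xsectionE indicE; have [xA|xA] := boolP (x \in A).
  rewrite (_ : _ @^-1` _ = setT) ?prob_kernel//.
  by apply/seteqP; split => // y _; exact: set_mem.
rewrite (_ : _ @^-1` _ = set0) ?measure0//.
by apply/seteqP; split => // y /mem_set/(negP xA).
Qed.

Lemma joint_snd B : measurable B -> joint (snd @^-1` B) = \int[mu]_x p x B.
Proof.
move=> mB; rewrite jointE; last first.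
  by rewrite -[X in measurable X]setTI; exact: measurable_snd.
by apply: eq_integral => x _; rewrite xsectionE.
Qed.

End joint.

Lemma measurable_preimage d d' (S : measurableType d) (T : measurableType d')
    (f : S -> T) B :
  measurable_fun [set: S] f -> measurable B -> measurable (f @^-1` B).
Proof. by move=> mf mB; rewrite -[X in measurable X]setTI; exact: mf. Qed.

(** * A layer cake formula for the positive part of a difference *)

Section layer_cake.
Context {d} {T : measurableType d} {R : realType}.
Variables (m : {sigma_finite_measure set T -> \bar R}) (X Y : T -> R).
Hypotheses (mX : measurable_fun [set: T] X) (mY : measurable_fun [set: T] Y).

Let E : set (T * R) := [set z | Y z.1 <= z.2 < X z.1].

Let mE : measurable E.
Proof.
have -> : E = (fun z : T * R => z.2 - Y z.1) @^-1` `[0, +oo[%classic `&`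
              (fun z : T * R => X z.1 - z.2) @^-1` `]0, +oo[%classic.
  apply/seteqP; split=> z; rewrite /E /setI/= !in_itv/= !andbT subr_ge0 subr_gt0.
    by move/andP.
  by move=> [-> ->].
apply: measurableI; apply: measurable_preimage.
- exact: (measurable_funB measurable_snd (measurableT_comp mY measurable_fst)).
- exact: measurable_itv.
- exact: (measurable_funB (measurableT_comp mX measurable_fst) measurable_snd).
- exact: measurable_itv.
Qed.

Lemma measurable_between s : measurable [set t | Y t <= s < X t].
Proof.
have := measurable_ysection s mE; congr measurable.
by apply/seteqP; split=> t /=; rewrite /ysection/= inE.
Qed.

Lemma measurable_fun_between :
  measurable_fun [set: R] (fun s => m [set t | Y t <= s < X t]).
Proof.
have := measurable_fun_ysection m mE; congr measurable_fun.
apply/funext => s /=; congr (m _); apply/seteqP.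
by split=> t /=; rewrite /ysection/= inE.
Qed.

(** The positive part of [X t - Y t] is the length of [[Y t, X t[], a section of [E]; Tonelli
    exchanges the two integrations. *)
Lemma layer_cake : (\int[m]_t (pos (X t - Y t))%:E =
                    \int[leb]_s m [set t | Y t <= s < X t]%R)%E.
Proof.
have := @indic_fubini_tonelli _ _ T R R m leb E mE.
rewrite indic_fubini_tonelli_FE// indic_fubini_tonelli_GE//= => h.
transitivity (\int[m]_t leb (xsection E t))%E.
  apply: eq_integral => t _; rewrite -(leb_itv true true); congr (leb _).
  by apply/seteqP; split=> s /=; rewrite /xsection/= inE /E/= in_itv.
rewrite h; apply: eq_integral => s _; congr (m _).
by apply/seteqP; split=> t /=; rewrite /ysection/= inE.
Qed.

End layer_cake.

(** * Lower bound for the classical cost *)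

Section classical_lower_bound.
Context {R : realType}.

Lemma quantile_hinge_le (mu nu : probability R R) d (T : measurableType d)
    (P : probability T R) (X Y : T -> R) (c : R) :
  measurable_fun [set: T] X -> measurable_fun [set: T] Y ->
  (forall t, P (X @^-1` `]-oo, t]%classic) = mu `]-oo, t]%classic) ->
  (forall t, P (Y @^-1` `]-oo, t]%classic) = nu `]-oo, t]%classic) ->
  (\int[unif]_u (pos (quantile mu u - quantile nu u - c))%:E <=
   \int[P]_t (pos (X t - Y t - c))%:E)%E.
Proof.
move=> mX mY lawX lawY.
have mYc : measurable_fun [set: T] (fun t => Y t + c) by exact: measurable_funD.
have mqc : measurable_fun [set: R] (fun t => quantile nu t + c).
  by apply: measurable_funD => //; exact: measurable_quantile.
have mq := measurable_quantile mu.
under eq_integral do rewrite -addrA -opprD.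
under [leRHS]eq_integral do rewrite -addrA -opprD.
rewrite (layer_cake unif mq mqc) (layer_cake P mX mYc).
apply: ge0_le_integral => //; [exact: measurable_fun_between..|move=> s _].
(* For the quantiles the Galois connection places the event inside []cdf mu s, cdf nu (s - c)]]. *)
apply: (@le_trans _ _ (pos (cdf nu (s - c) - cdf mu s))%:E).
  rewrite -unif_itv; [|exact: cdf_fine_ge0|exact: cdf_fine_le1].
  apply: (@le_measure _ _ _ leb (_ `&` `]0%R, 1%R[%classic)
    (_ `&` `]0%R, 1%R[%classic)); rewrite ?inE.
  - by apply: measurableI; [exact: measurable_between|exact: measurable_itv].
  - by apply: measurableI; exact: measurable_itv.
  move=> u /=; rewrite /setI/= !in_itv/= => -[/andP[ys sx] u01]; split => //.
  rewrite !quantileE// in ys sx.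
  by rewrite ltNge -!cdf_inv_le// -ltNge sx/= lerBrDr.
have mI A : measurable A -> measurable (X @^-1` A).
  exact: measurable_preimage.
have mJ A : measurable A -> measurable (Y @^-1` A).
  exact: measurable_preimage.
have mB := measurable_between mX mYc s.
(* Union bound: if [Y <= s - c], then either [X <= s] or [Y + c <= s < X]. *)
rewrite EFin_max ge_max measure_ge0 andbT EFinB leeBlDr// /cdf.
rewrite !fineK ?fin_num_measure//; try exact: measurable_itv.
rewrite -lawX -lawY.
apply: le_trans (measureU2 _ _ _) => //; last first.
  by apply: mI; exact: measurable_itv.
apply: le_measure; rewrite ?inE.
- by apply: mJ; exact: measurable_itv.
- by apply: measurableU => //; apply: mI; exact: measurable_itv.
- move=> t /=; rewrite !in_itv/= lerBrDr => ->.
  by have [_|] := leP (X t) s; [right|left].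
Qed.

Lemma classical_cost_ge (mu nu : probability R R) (theta : R -> R)
    (p : R.-pker R ~> R) :
  cost_function theta -> coupling_kernel mu nu p ->
  (\int[unif]_u (theta (quantile mu u - quantile nu u))%:E <=
   classical_cost_of theta mu p)%E.
Proof.
move=> cost mu_p_nu.
have mD : measurable_fun [set: R] (fun u => quantile mu u - quantile nu u).
  by apply: measurable_funB; exact: measurable_quantile.
have mZ : measurable_fun [set: R * R] (fun z : R * R => z.1 - z.2).
  by apply: measurable_funB.
have mth := measurable_cost cost.
have -> : classical_cost_of theta mu p =
    (\int[joint p mu]_z (theta (z.1 - z.2))%:E)%E.
  rewrite integral_joint//.
  - by under [RHS]eq_integral do under eq_integral do rewrite -(cost_norm cost).
  - by apply/measurable_EFinP; exact: measurableT_comp.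
  - by move=> z; rewrite lee_fin; case: cost.
have law1 t : joint p mu (fst @^-1` `]-oo, t]%classic) = mu `]-oo, t]%classic.
  by rewrite joint_fst//; exact: measurable_itv.
have law2 t : joint p mu (snd @^-1` `]-oo, t]%classic) = nu `]-oo, t]%classic.
  by rewrite joint_snd ?mu_p_nu//; exact: measurable_itv.
apply: (le_integral_cost cost) => // c _.
  exact: (@quantile_hinge_le mu nu _ _ (joint p mu)).
(* For the hinges of the opposite variable the two marginals exchange roles. *)
under eq_integral do rewrite opprB.
under [leRHS]eq_integral do rewrite opprB.
exact: (@quantile_hinge_le nu mu _ _ (joint p mu) snd fst).
Qed.

End classical_lower_bound.

(** * Hinge comparison from convex order *)

Section convex_order_hinge.
Context {R : realType} (X V b : R -> R) (c : R).
Hypotheses (mX : measurable_fun [set: R] X) (mV : measurable_fun [set: R] V).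
Hypothesis mb : measurable_fun [set: R] b.
Hypothesis b_le_V : forall t,
  (\int[unif]_u (pos (b u - t))%:E <= \int[unif]_u (pos (V u - t))%:E)%E.
Hypothesis V_fin : forall t, (\int[unif]_u (pos (V u - t))%:E < +oo)%E.
Hypothesis mean_b_V :
  (\int[unif]_u (pos (b u))%:E + \int[unif]_u (pos (- V u))%:E <=
   \int[unif]_u (pos (V u))%:E + \int[unif]_u (pos (- b u))%:E)%E.
Hypothesis mean_fin :
  (\int[unif]_u (pos (V u))%:E + \int[unif]_u (pos (- b u))%:E < +oo)%E.

Let pos_ge0 (x : R) : (0 <= (pos x)%:E)%E.
Proof. by rewrite lee_fin le_max lexx orbT. Qed.

Let mposE (f : R -> R) : measurable_fun [set: R] f ->
  measurable_fun [set: R] (fun u => (pos (f u))%:E).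
Proof. by move=> mf; apply/measurable_EFinP/measurable_pos. Qed.

(** The pointwise inequality is integrated with all terms nonnegative; then the integral of [h],
    which is finite and dominates that of [k], is cancelled. *)
Let cancel (f g h k : R -> \bar R) :
  measurable_fun [set: R] f -> measurable_fun [set: R] g ->
  measurable_fun [set: R] h -> measurable_fun [set: R] k ->
  (forall u : R, 0 <= f u)%E -> (forall u : R, 0 <= g u)%E ->
  (forall u : R, 0 <= h u)%E -> (forall u : R, 0 <= k u)%E ->
  (forall u : R, (0 < u < 1)%R -> f u + h u <= g u + k u)%E ->
  (\int[unif]_u k u <= \int[unif]_u h u)%E -> (\int[unif]_u h u < +oo)%E ->
  (\int[unif]_u f u <= \int[unif]_u g u)%E.
Proof.
move=> mf mg mh mk f0 g0 h0 k0 le_fg le_kh h_fin.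
have hf : (\int[unif]_u h u)%E \is a fin_num.
  by rewrite ge0_fin_numE// integral_ge0.
rewrite -(leeD2rE _ _ hf) -ge0_integralD//.
apply: le_trans (leeD2l _ le_kh); rewrite -ge0_integralD//.
apply: ae_ge0_le_integral => //.
- by move=> u _; rewrite adde_ge0.
- exact: emeasurable_funD.
- by move=> u _; rewrite adde_ge0.
- exact: emeasurable_funD.
- by apply: unif_ae => u u01 _; exact: le_fg.
Qed.

(** Here [X], [V], [b] stand for [q_mu], [q_nu] and the barycenter, or for their opposites. The
    first two cases are those without a finite threshold: either the left hinge vanishes, or it is
    affine in [V] and the comparison of means replaces that of the hinges at [t]. *)
Lemma hinge_le_of_convex_order :
  [\/ forall u, 0 < u < 1 -> X u - V u <= c,
      forall u, 0 < u < 1 -> c < X u - V u |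
      exists t, forall u, 0 < u < 1 ->
        if c < X u - V u then t <= V u else V u <= t] ->
  (\int[unif]_u (pos (X u - V u - c))%:E <=
   \int[unif]_u (pos (X u - b u - c))%:E)%E.
Proof.
have mXVc : measurable_fun [set: R] (fun u => (pos (X u - V u - c))%:E).
  by apply: mposE; do 2! apply: measurable_funB => //.
have mXbc : measurable_fun [set: R] (fun u => (pos (X u - b u - c))%:E).
  by apply: mposE; do 2! apply: measurable_funB => //.
have mN (f : R -> R) : measurable_fun [set: R] f ->
    measurable_fun [set: R] (fun u => - f u).
  by move=> mf; exact: measurableT_comp.
case=> [le_c|gt_c|[t tP]].
- apply: ae_ge0_le_integral => //; apply: unif_ae => u u01 _.
  by rewrite [X in (X%:E <= _)%E]max_r ?subr_le0 ?le_c.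
(* [X - V - c <= pos (X - b - c) + b - V], with [b] and [V] split into positive and negative parts
   so that every term is nonnegative. *)
- apply: (@cancel _ _ (fun u => (pos (V u))%:E + (pos (- b u))%:E)%E
    (fun u => (pos (b u))%:E + (pos (- V u))%:E)%E) => //.
  + by apply: emeasurable_funD; apply: mposE => //; exact: mN.
  + by apply: emeasurable_funD; apply: mposE => //; exact: mN.
  + by move=> u; rewrite adde_ge0.
  + by move=> u; rewrite adde_ge0.
  + move=> u /gt_c cu; rewrite -!EFinD lee_fin.
    case: (leP (X u - V u - c) 0); case: (leP (X u - b u - c) 0);
    case: (leP (V u) 0); case: (leP (- b u) 0); case: (leP (b u) 0);
    case: (leP (- V u) 0); lra.
  + by rewrite !ge0_integralD//; apply: mposE => //; exact: mN.
  + by rewrite !ge0_integralD//; apply: mposE => //; exact: mN.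
- apply: (@cancel _ _ (fun u => (pos (V u - t))%:E)
    (fun u => (pos (b u - t))%:E)) => //.
  + by apply: mposE => //; exact: measurable_funB.
  + by apply: mposE => //; exact: measurable_funB.
  + move=> u /tP; rewrite -!EFinD lee_fin; case: ltP => cu tu.
      rewrite (@max_l _ _ (X u - V u - c)) ?subr_ge0 ?(ltW cu)//.
      rewrite (@max_l _ _ (V u - t)) ?subr_ge0//.
      have -> : X u - V u - c + (V u - t) = X u - b u - c + (b u - t) by ring.
      by rewrite lerD// le_max lexx.
    rewrite (@max_r _ _ (X u - V u - c)) ?subr_le0//.
    rewrite (@max_r _ _ (V u - t)) ?subr_le0//.
    by rewrite addr0 addr_ge0// le_max lexx orbT.
Qed.

End convex_order_hinge.

(** * The barycenter map of a coupling *)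

Section barycenter.
Context {R : realType} (mu nu : probability R R) (p : R.-pker R ~> R).
Hypothesis mu_p_nu : coupling_kernel mu nu p.

Lemma integral_coupling (f : R -> \bar R) : measurable_fun [set: R] f ->
  (forall y, 0 <= f y)%E ->
  (\int[mu]_x \int[p x]_y f y = \int[nu]_y f y)%E.
Proof.
move=> mf f0; have mf2 : measurable_fun [set: R * R] (f \o snd).
  exact: measurableT_comp.
rewrite -(integral_joint p mu mf2)//.
rewrite -(preimage_setT snd).
rewrite -(ge0_integral_pushforward measurable_snd (joint p mu))//.
apply: eq_measure_integral => A mA _.
  exact: (eq_trans (joint_snd p mu mA) (mu_p_nu mA)).
by move=> z; exact: f0.
Qed.

Hypothesis nu_fin : finite_first_moment nu.

Let pos_ge0 (x : R) : (0 <= (pos x)%:E)%E.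
Proof. by rewrite lee_fin le_max lexx orbT. Qed.

Let mpos (f : R -> R) : measurable_fun [set: R] f ->
  measurable_fun [set: R] (fun u => (pos (f u))%:E).
Proof. by move=> mf; apply/measurable_EFinP/measurable_pos. Qed.

Let mN (f : R -> R) : measurable_fun [set: R] f ->
  measurable_fun [set: R] (fun u => - f u).
Proof. by move=> mf; exact: measurableT_comp. Qed.

Let mid : measurable_fun [set: R] (fun y : R => y).
Proof. exact: measurable_id. Qed.

(** Positive and negative parts of the mean of [p x]. The first moment of [nu] makes both finite for
    almost every [x]; elsewhere [bary] may be a default value of [fine]. *)
Let kp x := (\int[p x]_y (pos y)%:E)%E.
Let kn x := (\int[p x]_y (pos (- y))%:E)%E.

Let mkernel (f : R -> \bar R) : measurable_fun [set: R] f ->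
  (forall y, 0 <= f y)%E ->
  measurable_fun [set: R] (fun x => \int[p x]_y f y)%E.
Proof.
move=> mf f0; apply: measurable_fun_integral_kernel => // U mU.
exact: measurable_kernel.
Qed.

Let mkp : measurable_fun [set: R] kp.
Proof. by apply: mkernel => //; exact: mpos. Qed.

Let mkn : measurable_fun [set: R] kn.
Proof. by apply: mkernel => //; apply: mpos; exact: mN. Qed.

Let kp_ge0 x : (0 <= kp x)%E. Proof. exact: integral_ge0. Qed.
Let kn_ge0 x : (0 <= kn x)%E. Proof. exact: integral_ge0. Qed.

Let baryE x : bary p x = fine (kp x - kn x)%E.
Proof.
rewrite /bary integralE; congr (fine (_ - _)%E); apply: eq_integral => y _.
  by rewrite /kp funeposE/= EFin_max.
by rewrite /kn funenegE/= EFin_max EFinN.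
Qed.

Lemma measurable_bary : measurable_fun [set: R] (bary p).
Proof.
have -> : bary p = fine \o (fun x => kp x - kn x)%E.
  by apply/funext => x /=; exact: baryE.
by apply: measurableT_comp; [exact: fine_measurable|exact: emeasurable_funB].
Qed.

Let int_norm_fin (f : R -> R) : measurable_fun [set: R] f ->
  (forall y, 0 <= f y <= `|y|) -> (\int[nu]_y (f y)%:E < +oo)%E.
Proof.
move=> mf f_le; apply: le_lt_trans nu_fin; apply: ge0_le_integral => //.
- by move=> y _; rewrite lee_fin; have /andP[] := f_le y.
- exact/measurable_EFinP.
- by apply/measurable_EFinP.
- by move=> y _; rewrite lee_fin; have /andP[] := f_le y.
Qed.

Let kp_fin : (\int[mu]_x kp x < +oo)%E.
Proof.
rewrite (integral_coupling (mpos mid) (fun y => pos_ge0 y)).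
apply: int_norm_fin => [|y]; first exact: measurable_pos.
by rewrite le_max lexx orbT ge_max ler_norm normr_ge0.
Qed.

Let kn_fin : (\int[mu]_x kn x < +oo)%E.
Proof.
rewrite (integral_coupling (mpos (mN mid)) (fun y => pos_ge0 (- y))).
apply: int_norm_fin => [|y]; first by apply: measurable_pos; exact: mN.
by rewrite le_max lexx orbT ge_max -normrN ler_norm normr_ge0.
Qed.

Let ae_fin (k : R -> \bar R) : measurable_fun [set: R] k ->
  (forall x, 0 <= k x)%E -> (\int[mu]_x k x < +oo)%E ->
  {ae mu, forall x, k x \is a fin_num}.
Proof.
move=> mk k0 k_fin; have ik : mu.-integrable setT k.
  apply/integrableP; split => //.
  by under eq_integral do rewrite gee0_abs//.
have := integrable_ae measurableT ik.
by apply: filterS => x; exact.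
Qed.

(** Equality of the means of [bary p] and [nu], with negative parts moved across so that only
    nonnegative integrals occur. It integrates an identity valid wherever [kp] and [kn] are
    finite. *)
Lemma integral_bary_mean :
  (\int[mu]_x (pos (bary p x))%:E + \int[nu]_y (pos (- y))%:E =
   \int[nu]_y (pos y)%:E + \int[mu]_x (pos (- bary p x))%:E)%E.
Proof.
have mb := measurable_bary.
rewrite -(integral_coupling (mpos mid) (fun y => pos_ge0 y)).
rewrite -(integral_coupling (mpos (mN mid)) (fun y => pos_ge0 (- y))).
rewrite -ge0_integralD//; [|exact: mpos|by move=> x _; exact: kn_ge0].
rewrite -ge0_integralD//; [|by move=> x _; exact: kp_ge0|by apply: mpos; exact: mN].
apply: ge0_ae_eq_integral => //.
- by apply: emeasurable_funD => //; exact: mpos.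
- by apply: emeasurable_funD; [exact: mkp|apply: mpos; exact: mN].
- by move=> x _; rewrite adde_ge0//; exact: kn_ge0.
- by move=> x _; rewrite adde_ge0//; exact: kp_ge0.
have := ae_fin mkp kp_ge0 kp_fin; have := ae_fin mkn kn_ge0 kn_fin.
apply: filterS2 => x nfin pfin _; rewrite baryE.
rewrite -/(kp x) -/(kn x) -(fineK nfin) -(fineK pfin) -EFinB -!EFinD /=.
congr (_%:E); set a := fine (kp x); set c := fine (kn x).
by case: (leP (a - c) 0); case: (leP (- (a - c)) 0); lra.
Qed.

(** Jensen for a hinge: integrate [e - t <= pos (e - t)] after splitting [e] and [t] into positive
    and negative parts. It serves for [e y = y] and for [e y = - y]. *)
Let jensen_hinge (e : R -> R) x t : measurable_fun [set: R] e ->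
  (\int[p x]_y (pos (e y))%:E)%E \is a fin_num ->
  (\int[p x]_y (pos (- e y))%:E)%E \is a fin_num ->
  ((pos (fine (\int[p x]_y (pos (e y))%:E) -
         fine (\int[p x]_y (pos (- e y))%:E) - t))%:E <=
   \int[p x]_y (pos (e y - t))%:E)%E.
Proof.
move=> me fin1 fin2; have met : measurable_fun [set: R] (fun y => e y - t).
  exact: measurable_funB.
set J := (\int[p x]_y (pos (e y - t))%:E)%E.
have J0 : (0 <= J)%E by exact: integral_ge0.
have [|Jfin] := eqVneq J +oo%E; first by move=> ->; rewrite leey.
have {}Jfin : J \is a fin_num by rewrite ge0_fin_numE// lt_neqAle Jfin leey.
have cst (a : R) : (\int[p x]_y a%:E = a%:E)%E.
  by rewrite integral_cst// [X in (_ * X)%E]prob_kernel mule1.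
have : (\int[p x]_y ((pos (e y))%:E + (pos (- t))%:E) <=
    \int[p x]_y ((pos (e y - t))%:E + ((pos (- e y))%:E + (pos t)%:E)))%E.
  apply: ge0_le_integral => //.
  - by move=> y _; rewrite adde_ge0.
  - by apply: emeasurable_funD => //; exact: mpos.
  - apply: emeasurable_funD; first exact: mpos.
    by apply: emeasurable_funD => //; apply: mpos; exact: mN.
  - move=> y _; rewrite -!EFinD lee_fin.
    case: (leP (e y) 0); case: (leP (- t) 0); case: (leP (e y - t) 0);
    case: (leP (- e y) 0); case: (leP t 0); lra.
have mp := mpos me; have mn := mpos (mN me); have mt := mpos met.
have mns : measurable_fun [set: R] (fun y => (pos (- e y))%:E + (pos t)%:E)%E.
  exact: emeasurable_funD.
rewrite ge0_integralD// ge0_integralD//; last by move=> y _; rewrite adde_ge0.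
rewrite ge0_integralD//.
have j0 : 0 <= fine J by exact: fine_ge0.
rewrite !cst -/J -(fineK fin1) -(fineK fin2) -(fineK Jfin) -!EFinD !lee_fin /=.
set j := fine J in j0 *; set a := fine _; set b := fine _ => le_ab.
by move: le_ab; rewrite ge_max j0 andbT; case: (leP (- t) 0); case: (leP t 0); lra.
Qed.

Lemma integral_bary_hinge t :
  (\int[mu]_x (pos (bary p x - t))%:E <= \int[nu]_y (pos (y - t))%:E)%E.
Proof.
have mb := measurable_bary.
have myt : measurable_fun [set: R] (fun y => y - t) by exact: measurable_funB.
rewrite -(integral_coupling (mpos myt) (fun y => pos_ge0 (y - t))).
apply: ae_ge0_le_integral => //.
- by apply: mpos; exact: measurable_funB.
- by move=> x _; exact: integral_ge0.
- by apply: mkernel => //; exact: mpos.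
have := ae_fin mkp kp_ge0 kp_fin; have := ae_fin mkn kn_ge0 kn_fin.
apply: filterS2 => x nfin pfin _; rewrite baryE fineB//.
exact: (jensen_hinge t mid).
Qed.

Lemma integral_bary_hingeN t :
  (\int[mu]_x (pos (- bary p x - t))%:E <= \int[nu]_y (pos (- y - t))%:E)%E.
Proof.
have mb := measurable_bary.
have myt : measurable_fun [set: R] (fun y : R => - y - t).
  by apply: measurable_funB => //; exact: mN.
rewrite -(integral_coupling (mpos myt) (fun y => pos_ge0 (- y - t))).
apply: ae_ge0_le_integral => //.
- by apply: mpos; apply: measurable_funB => //; exact: mN.
- by move=> x _; exact: integral_ge0.
- by apply: mkernel => //; exact: mpos.
have := ae_fin mkp kp_ge0 kp_fin; have := ae_fin mkn kn_ge0 kn_fin.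
apply: filterS2 => x nfin pfin _; rewrite baryE fineB// opprB.
have kpE : (\int[p x]_y (pos (- - y))%:E)%E = kp x.
  by apply: eq_integral => y _; rewrite opprK.
have := @jensen_hinge (fun y => - y) x t (mN mid) nfin.
by rewrite kpE; exact.
Qed.

End barycenter.

(** * Lower bound for the weak cost when [D] is nondecreasing *)

Section weak_lower_bound.
Context {R : realType}.

Definition nd01 (D : R -> R) :=
  forall u v, 0 < u -> u <= v -> v < 1 -> D u <= D v.

(** The threshold is the infimum of [V] over the upper set where [D] exceeds [c]. A point off that
    set bounds [V] from below on it, hence the separate case where the set is the whole interval. *)
Lemma nd01_threshold (D V : R -> R) c : nd01 D -> nd01 V ->
  [\/ forall u, 0 < u < 1 -> D u <= c,
      forall u, 0 < u < 1 -> c < D u |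
      exists t, forall u, 0 < u < 1 -> if c < D u then t <= V u else V u <= t].
Proof.
move=> Dnd Vnd.
have [?|] := pselect (forall u, 0 < u < 1 -> D u <= c); first exact: Or31.
move=> /existsNP[u1 /not_implyP[u101 /negP]]; rewrite -ltNge => cu1.
have [?|] := pselect (forall u, 0 < u < 1 -> c < D u); first exact: Or32.
move=> /existsNP[u0 /not_implyP[u001 /negP]]; rewrite -leNgt => u0c.
apply: Or33; pose A := [set V u | u in [set u | 0 < u < 1 /\ c < D u]].
have sep u v : 0 < u < 1 -> 0 < v < 1 -> D u <= c -> c < D v -> V u <= V v.
  move=> /andP[lt0u ltu1] /andP[lt0v ltv1] uc cv.
  have [uv|/ltW vu] := leP u v; first exact: Vnd.
  by have := lt_le_trans cv (le_trans (Dnd _ _ lt0v vu ltu1) uc); rewrite ltxx.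
have lbA u : 0 < u < 1 -> D u <= c -> lbound A (V u).
  by move=> u01 uc _ [v [v01 cv] <-]; exact: sep.
exists (inf A) => u u01; case: ifPn => [cu|]; last rewrite -leNgt => uc.
  by apply: ge_inf; [exists (V u0); exact: lbA|exists u].
by apply: lb_le_inf; [exists (V u1), u1|exact: lbA].
Qed.

(** The reflection [u] to [1 - u] makes the opposites nondecreasing. *)
Lemma nd01_threshold_opp (D V : R -> R) c : nd01 D -> nd01 V ->
  [\/ forall u, 0 < u < 1 -> - D u <= c,
      forall u, 0 < u < 1 -> c < - D u |
      exists t, forall u, 0 < u < 1 -> if c < - D u then t <= - V u else - V u <= t].
Proof.
move=> Dnd Vnd; have rnd (f : R -> R) : nd01 f -> nd01 (fun u => - f (1 - u)).
  by move=> fnd u v u0 uv v1; rewrite lerN2 fnd//; lra.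
have := nd01_threshold c (rnd _ Dnd) (rnd _ Vnd).
have U (u : R) : 0 < u < 1 -> 0 < 1 - u < 1 by lra.
have K (u : R) : 1 - (1 - u) = u by rewrite opprB addrC subrK.
case=> [h|h|[t h]]; [apply: Or31|apply: Or32|apply: Or33; exists t];
  by move=> u /U /h; rewrite K.
Qed.

Lemma quantile_nd01 (mu : probability R R) : nd01 (quantile mu).
Proof.
move=> u v u0 uv v1; rewrite !quantileE ?cdf_inv_nd ?u0 ?(lt_le_trans u0)//.
by rewrite (le_lt_trans uv).
Qed.

Lemma weak_cost_ge (mu nu : probability R R) (theta : R -> R)
    (p : R.-pker R ~> R) :
  finite_first_moment nu -> cost_function theta -> coupling_kernel mu nu p ->
  nd01 (fun u => quantile mu u - quantile nu u) ->
  (\int[unif]_u (theta (quantile mu u - quantile nu u))%:E <=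
   weak_cost_of theta mu p)%E.
Proof.
move=> nu_fin cost mu_p_nu Dnd.
have mth := measurable_cost cost.
have mb := measurable_bary p.
have mX := measurable_quantile mu; have mV := measurable_quantile nu.
(* Pulled back by [quantile mu], the barycenter lives on the same space as [quantile nu]. It is not
   coupled to it by [p] there, but convex order involves only the laws. *)
pose b u := bary p (quantile mu u).
have mbX : measurable_fun [set: R] b by exact: measurableT_comp.
have mN (f : R -> R) : measurable_fun [set: R] f ->
  measurable_fun [set: R] (fun u => - f u) by move=> mf; exact: measurableT_comp.
have mpos (f : R -> R) : measurable_fun [set: R] f ->
    measurable_fun [set: R] (fun u => (pos (f u))%:E).
  by move=> mf; apply/measurable_EFinP/measurable_pos.
have p0 (x : R) : (0 <= (pos x)%:E)%E by rewrite lee_fin le_max lexx orbT.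
have -> : weak_cost_of theta mu p =
    (\int[unif]_u (theta (quantile mu u - b u))%:E)%E.
  rewrite /weak_cost_of.
  under eq_integral do rewrite (cost_norm cost).
  rewrite integral_quantile//.
    by apply/measurable_EFinP; apply: measurableT_comp => //; exact: measurable_funB.
  by move=> x; rewrite lee_fin; case: cost.
have toV (f : R -> R) : measurable_fun [set: R] f ->
    (\int[unif]_u (pos (f (quantile nu u)))%:E = \int[nu]_y (pos (f y))%:E)%E.
  by move=> mf; rewrite (integral_quantile _ (mpos _ mf)).
have tob (f : R -> R) : measurable_fun [set: R] f ->
    (\int[unif]_u (pos (f (b u)))%:E = \int[mu]_x (pos (f (bary p x)))%:E)%E.
  move=> mf; have mfb : measurable_fun [set: R] (fun x => f (bary p x)).
    exact: measurableT_comp.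
  by rewrite (integral_quantile _ (mpos _ mfb)).
have mid : measurable_fun [set: R] (fun y : R => y) by exact: measurable_id.
have mB t : measurable_fun [set: R] (fun y : R => y - t) by exact: measurable_funB.
have mBN t : measurable_fun [set: R] (fun y : R => - y - t).
  by apply: measurable_funB => //; exact: mN.
have fin t (e : R -> R) : measurable_fun [set: R] e -> (forall y, `|e y| = `|y|) ->
    (\int[nu]_y (pos (e y - t))%:E < +oo)%E.
  move=> me eN; apply: (@le_lt_trans _ _ (\int[nu]_y (`|y|%:E + `|t|%:E))%E).
    apply: ge0_le_integral => //.
    - by apply: mpos; exact: measurable_funB.
    - by apply: emeasurable_funD => //; exact/measurable_EFinP.
    - move=> y _; rewrite -EFinD lee_fin ge_max addr_ge0// andbT -eN.
      by rewrite lerD ?ler_norm// -normrN ler_norm.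
  rewrite ge0_integralD//; last exact/measurable_EFinP.
  rewrite integral_cst// [X in (_ * X)%E]probability_setT mule1.
  by rewrite lte_add_pinfty ?ltry.
have finp t := fin t _ mid (fun=> erefl).
have finn t := fin t _ (mN _ mid) (fun y => normrN y).
have mean := integral_bary_mean mu_p_nu nu_fin.
have sub0 (f : R -> R) (m : {measure set R -> \bar R}) :
    (\int[m]_y (pos (f y - 0))%:E = \int[m]_y (pos (f y))%:E)%E.
  by apply: eq_integral => y _; rewrite subr0.
have Vp_fin : (\int[nu]_y (pos y)%:E < +oo)%E.
  by rewrite -(sub0 id); exact: finp.
have Vn_fin : (\int[nu]_y (pos (- y))%:E < +oo)%E.
  by rewrite -(sub0 (fun y => - y)); exact: finn.
have hp := integral_bary_hinge mu_p_nu nu_fin.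
have hn := integral_bary_hingeN mu_p_nu nu_fin.
have bp_fin : (\int[mu]_x (pos (bary p x))%:E < +oo)%E.
  by have := hp 0; rewrite (sub0 (bary p)) (sub0 id) => /le_lt_trans; exact.
have bn_fin : (\int[mu]_x (pos (- bary p x))%:E < +oo)%E.
  have := hn 0; rewrite (sub0 (fun x => - bary p x)) (sub0 (fun y => - y)).
  by move=> /le_lt_trans; exact.
have opp2 (f : R -> R) :
    (\int[unif]_u (pos (- - f u))%:E = \int[unif]_u (pos (f u))%:E)%E.
  by apply: eq_integral => y _; rewrite opprK.
have [bp bn] := (tob id mid, tob _ (mN _ mid)).
have [Vp Vn] := (toV id mid, toV _ (mN _ mid)).
apply: (le_integral_cost cost) => //; try exact: measurable_funB.
- move=> c _; apply: (hinge_le_of_convex_order mX mV mbX).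
  + by move=> t; rewrite (toV (fun y => y - t)) ?(tob (fun y => y - t)).
  + by move=> t; rewrite (toV (fun y => y - t)).
  + by rewrite bp Vn Vp bn mean.
  + by rewrite Vp bn lte_add_pinfty.
  + exact: (nd01_threshold c Dnd (@quantile_nd01 nu)).
(* The other hinges follow from the same comparison applied to the opposites of [X], [V] and [b]. *)
- move=> c _.
  have E (x y : R) : - (x - y) - c = - x - - y - c by rewrite opprB opprK; lra.
  under eq_integral do rewrite E.
  under [leRHS]eq_integral do rewrite E.
  apply: (hinge_le_of_convex_order (mN _ mX) (mN _ mV) (mN _ mbX)).
  + by move=> t; rewrite (toV (fun y => - y - t)) ?(tob (fun y => - y - t)).
  + by move=> t; rewrite (toV (fun y => - y - t)).
  + by rewrite !opp2 bn Vp Vn bp addeC -mean addeC.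
  + by rewrite opp2 Vn bp lte_add_pinfty.
  + case: (nd01_threshold_opp c Dnd (@quantile_nd01 nu)) => [h|h|[t h]].
    * by apply: Or31 => u /h; rewrite opprB opprK addrC.
    * by apply: Or32 => u /h; rewrite opprB opprK addrC.
    * by apply: Or33; exists t => u /h; rewrite opprB opprK addrC.
Qed.

End weak_lower_bound.

(** * Kernels with two atoms *)

Section two_point_kernel.
Context {R : realType} (f g : R -> R) (s t : {nonneg R}).
Hypotheses (mf : measurable_fun [set: R] f) (mg : measurable_fun [set: R] g).
Hypothesis st1 : s%:num + t%:num = 1.
Local Open Scope ereal_scope.

(** The proofs are arguments of the term so that the kernel instances below can recover them from
    it. *)
Definition two_point (_ : measurable_fun [set: R] f) (_ : measurable_fun [set: R] g)
    (_ : (s%:num + t%:num = 1)%R) (x : R) : {measure set R -> \bar R} :=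
  measure_add (mscale s (dirac (f x))) (mscale t (dirac (g x))).

Local Notation k := (two_point mf mg st1).

Lemma two_pointE x A : k x A = (s%:num * \1_A (f x) + t%:num * \1_A (g x))%:E.
Proof.
by rewrite [LHS](measure_addE (mscale s (dirac (f x))) (mscale t (dirac (g x)))).
Qed.

Let measurable_two_point U : measurable U -> measurable_fun setT (k ^~ U).
Proof.
move=> mU; rewrite (_ : k ^~ U = fun x =>
  (s%:num * \1_U (f x) + t%:num * \1_U (g x))%:E); last first.
  by apply/funext => x; exact: two_pointE.
apply/measurable_EFinP/measurable_funD; apply: measurable_funM => //;
  exact: measurableT_comp.
Qed.

HB.instance Definition _ := isKernel.Build _ _ _ _ _ k measurable_two_point.

Let two_point_prob x : k x [set: R] = 1.
Proof. by rewrite two_pointE !indicT !mulr1 st1. Qed.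

HB.instance Definition _ := Kernel_isProbability.Build _ _ _ _ _ k two_point_prob.

Lemma integral_two_point (h : R -> R) x : measurable_fun [set: R] h ->
  (forall y, 0 <= h y)%R ->
  \int[k x]_y (h y)%:E = (s%:num * h (f x) + t%:num * h (g x))%:E.
Proof.
move=> mh h0; have mhE : measurable_fun [set: R] (EFin \o h).
  exact/measurable_EFinP.
rewrite /two_point ge0_integral_measure_add//; last by move=> y _; rewrite lee_fin.
rewrite !ge0_integral_mscale//; try by move=> y _; rewrite lee_fin.
by rewrite !integral_dirac// !diracT !mul1e EFinD !EFinM.
Qed.

Lemma bary_two_point x : bary k x = (s%:num * f x + t%:num * g x)%R.
Proof.
rewrite /bary integralE.
have -> : \int[k x]_y (fun y : R => y%:E)^\+ y =
    \int[k x]_y (Num.max y 0%R)%:E.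
  by apply: eq_integral => y _; rewrite funeposE/= EFin_max.
have -> : \int[k x]_y (fun y : R => y%:E)^\- y =
    \int[k x]_y (Num.max (- y)%R 0%R)%:E.
  by apply: eq_integral => y _; rewrite funenegE/= EFin_max EFinN.
rewrite !integral_two_point//=.
- have posB (z : R) : (pos z - pos (- z) = z)%R.
    by case: (leP z 0%R); case: (leP (- z)%R 0%R); lra.
  by rewrite opprD addrACA -!mulrBr !posB.
- have mN (e : R -> R) : measurable_fun [set: R] e ->
      measurable_fun [set: R] (fun y => - e y)%R.
    by move=> me; exact: measurableT_comp.
  by apply: measurable_pos; apply: (mN id); exact: measurable_id.
- by move=> y; rewrite le_max lexx orbT.
- exact: measurable_pos.
- by move=> y; rewrite le_max lexx orbT.
Qed.

End two_point_kernel.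

(** * Exchange of two intervals under the uniform law *)

Lemma leb_shift {R : realType} (A : set R) (c : R) : measurable A ->
  leb ((fun x => x + c) @^-1` A) = leb A.
Proof.
move=> mA; have mc : measurable_fun [set: measurableTypeR R]
    ((fun x => x + c) : measurableTypeR R -> measurableTypeR R).
  exact: (@measurable_funD _ R R _ _ _ (@measurable_id _ R setT) (measurable_cst c)).
pose m := measure_function_pushforward__canonical__measure_function_Measure
  (@lebesgue_measure R) mc.
apply/esym; apply: (@lebesgue_measure_unique _ m) => // _ [[a b]] _ <-.
rewrite /m /= /pushforward (_ : _ @^-1` _ = `]a - c, b - c]%classic); last first.
  by apply/seteqP; split=> x /=; rewrite !in_itv/= ltrBlDr lerBrDr.
rewrite !lebesgue_measure_itv/= !lte_fin ltrD2r; case: ifP => // _.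
by rewrite -!EFinB; congr (_%:E); ring.
Qed.

Section swap.
Context {R : realType} (w u v : R).
Hypotheses (w0 : 0 <= w) (wu : w < u) (v1 : v < 1).
Hypothesis uwv : u <= w + (v - u).

(** Exchanges []w, u]] with its translate []w + (v - u), v]]; the hypothesis [uwv] makes the two
    disjoint. *)
Definition swap (x : R) : R :=
  if w < x <= u then x + (v - u)
  else if w + (v - u) < x <= v then x - (v - u) else x.

Variant swap_spec x : R -> Prop :=
| SwapL of w < x <= u & w + (v - u) < x + (v - u) <= v : swap_spec x (x + (v - u))
| SwapR of w + (v - u) < x <= v & w < x - (v - u) <= u : swap_spec x (x - (v - u))
| SwapI of ~ (w < x <= u) & ~ (w + (v - u) < x <= v) : swap_spec x x.

(* [lra] only uses the section hypotheses once they are in the goal. *)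
Local Ltac by_swap := have := w0; have := wu; have := v1; have := uwv; lra.

Lemma swapP x : swap_spec x (swap x).
Proof.
rewrite /swap; case: ifPn => [|/negP] x1; first by apply: SwapL => //; by_swap.
by case: ifPn => [|/negP] x2; [apply: SwapR => //; by_swap|exact: SwapI].
Qed.

Lemma swapK : involutive swap.
Proof.
move=> x; case: (swapP x) => [x1 x2|x1 x2|x1 x2]; rewrite /swap.
- by rewrite x2 ifF ?addrK//; apply/negbTE/negP; by_swap.
- by rewrite x2 subrK.
- by rewrite (introF idP x1) (introF idP x2).
Qed.

Lemma measurable_swap : measurable_fun [set: R] swap.
Proof.
have mI a b : measurable_fun [set: R] (fun x : R => a < x <= b).
  apply: measurable_and; first exact: measurable_fun_ltr.
  exact: measurable_fun_ler.
apply: measurable_fun_ifT => //; first exact: measurable_funD.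
by apply: measurable_fun_ifT => //; exact: measurable_funB.
Qed.

(** Split along the two intervals and the rest: [swap] translates each interval onto the other and
    fixes the rest. *)
Lemma unif_swap A : measurable A -> unif (swap @^-1` A) = unif A.
Proof.
move=> mA; pose U : set R := `]0, 1[%classic.
pose I1 : set R := `]w, u]%classic; pose I2 : set R := `]w + (v - u), v]%classic.
have mI1 : measurable I1 by exact: measurable_itv.
have mI2 : measurable I2 by exact: measurable_itv.
have mU : measurable U by exact: measurable_itv.
have msA : measurable (swap @^-1` A).
  by apply: measurable_preimage => //; exact: measurable_swap.
have split3 B : measurable B -> leb B =
    (leb (B `&` I1) + (leb (B `&` I2) + leb (B `\` I1 `\` I2)))%E.
  move=> mB; rewrite (measureDI _ mB mI1) addeC; congr (_ + _)%E.
  rewrite (measureDI _ (measurableD mB mI1) mI2) addeC; congr (leb _ + _)%E.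
  apply/seteqP; split=> x; first by move=> [[]].
  move=> [Bx x2]; split => //; split => //; move: x2.
  by rewrite /I1 /I2 /= !in_itv/= => x2 x1; by_swap.
rewrite /unif /mrestr -/U split3; last exact: measurableI.
rewrite [RHS]split3; last exact: measurableI.
have -> : swap @^-1` A `&` U `&` I1 = (fun x => x + (v - u)) @^-1` (A `&` U `&` I2).
  apply/seteqP; split=> x; rewrite /U /I1 /I2 /setI/= !in_itv/=.
    by move=> [[+ x01 x1]]; case: (swapP x) => // *; repeat split => //; by_swap.
  move=> [[Ax x01 x1]]; split; last by by_swap.
  by split; [case: (swapP x) => // *; by_swap|by_swap].
have -> : swap @^-1` A `&` U `&` I2 = (fun x => x + (u - v)) @^-1` (A `&` U `&` I1).
  apply/seteqP; split=> x; rewrite /U /I1 /I2 /setI/= !in_itv/= -[u - v]opprB.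
    by move=> [[+ x01 x1]]; case: (swapP x) => // *; repeat split => //; by_swap.
  move=> [[Ax x01 x1]]; split; last by by_swap.
  by split; [case: (swapP x) => // *; by_swap|by_swap].
have -> : (swap @^-1` A `&` U) `\` I1 `\` I2 = (A `&` U) `\` I1 `\` I2.
  apply/seteqP; split=> x; rewrite /U /I1 /I2 /setD /setI/= !in_itv/=.
    by move=> [[[+ x01] x1] x2]; case: (swapP x).
  by move=> [[[+ x01] x1] x2]; case: (swapP x).
have mAUI1 : measurable (A `&` U `&` I1) by do 2! apply: measurableI => //.
have mAUI2 : measurable (A `&` U `&` I2) by do 2! apply: measurableI => //.
by rewrite (leb_shift (v - u) mAUI2) (leb_shift (u - v) mAUI1) addeCA.
Qed.

End swap.

(** * Couplings from rearranged quantiles *)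

Section quantile_rearrangement.
Context {R : realType} (mu nu : probability R R) (theta sigma : R -> R).
Variables s t : {nonneg R}.
Hypotheses (st1 : s%:num + t%:num = 1) (mu_leb : mu `<< @lebesgue_measure R).
Hypotheses (cost : cost_function theta) (msigma : measurable_fun [set: R] sigma).
Hypothesis unif_sigma : forall A, measurable A -> unif (sigma @^-1` A) = unif A.

(** The monotone transport map, and the same map with ranks permuted by [sigma]. Both carry [mu] to
    [nu], since [mu] has no atoms and [sigma] preserves the uniform law; so does any mixture of the
    two. *)
Let monge (x : R) := quantile nu (cdf mu x).
Let monge_sigma (x : R) := quantile nu (sigma (cdf mu x)).

Let mcdf : measurable_fun [set: R] (cdf mu).
Proof. by apply: nondecreasing_measurable => //; exact: cdf_nd. Qed.

Let mqmu := measurable_quantile mu.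
Let mqnu := measurable_quantile nu.

Let mqnus : measurable_fun [set: R] (fun u => quantile nu (sigma u)).
Proof. exact: measurableT_comp. Qed.

Let mmonge : measurable_fun [set: R] monge.
Proof. exact: measurableT_comp. Qed.

Let mmonge_sigma : measurable_fun [set: R] monge_sigma.
Proof. by apply: (measurableT_comp mqnus). Qed.

Definition rearrangement_kernel : R.-pker R ~> R :=
  two_point mmonge mmonge_sigma st1.

Lemma integral_sigma (f : R -> R) : measurable_fun [set: R] f ->
  (forall y, 0 <= f y) ->
  (\int[unif]_u (f (sigma u))%:E = \int[unif]_u (f u)%:E)%E.
Proof.
move=> mf f0; have mfE : measurable_fun [set: R] (fun u => (f u)%:E).
  exact/measurable_EFinP.
rewrite -[in LHS](preimage_setT sigma).
rewrite -(ge0_integral_pushforward msigma unif measurableT mfE)//; last first.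
  by move=> y _; rewrite lee_fin.
by apply: eq_measure_integral => A mA _; exact: unif_sigma.
Qed.

(** Change of variables [x = quantile mu u]; the absolute continuity of [mu] turns [cdf mu x] back
    into [u] on []0, 1[]. *)
Let integral_cdf (F : R -> R -> R) :
  measurable_fun [set: R] (fun x => F x (cdf mu x)) ->
  measurable_fun [set: R] (fun u => F (quantile mu u) u) ->
  (forall x y, 0 <= F x y) ->
  (\int[mu]_x (F x (cdf mu x))%:E = \int[unif]_u (F (quantile mu u) u)%:E)%E.
Proof.
move=> mF1 mF2 F0.
rewrite (integral_quantile mu (f := fun x => (F x (cdf mu x))%:E)); last 2 first.
- exact/measurable_EFinP.
- by move=> x; rewrite lee_fin.
apply: ge0_ae_eq_integral => //.
- apply/measurable_EFinP; exact: (measurableT_comp mF1 mqmu).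
- exact/measurable_EFinP.
- by move=> u _; rewrite lee_fin.
- by move=> u _; rewrite lee_fin.
by apply: unif_ae => u u01 _; rewrite quantileE// cdf_cdf_inv.
Qed.

Lemma rearrangement_coupling : coupling_kernel mu nu rearrangement_kernel.
Proof.
move=> B mB.
have mind : measurable_fun [set: R] (\1_B : R -> R) by exact: measurable_indic.
have ind0 (y : R) : 0 <= \1_B y :> R by [].
under eq_integral do rewrite two_pointE.
rewrite (integral_cdf (F := fun _ u => s%:num * \1_B (quantile nu u) +
    t%:num * \1_B (quantile nu (sigma u)))); last 3 first.
- by apply: measurable_funD; apply: measurable_funM => //; exact: measurableT_comp.
- by apply: measurable_funD; apply: measurable_funM => //; exact: measurableT_comp.
- by move=> _ u; rewrite addr_ge0// mulr_ge0.
have mq1 : measurable_fun [set: R] (fun u => (\1_B (quantile nu u))%:E : \bar R).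
  by apply/measurable_EFinP; exact: measurableT_comp.
have mq2 : measurable_fun [set: R]
    (fun u => (\1_B (quantile nu (sigma u)))%:E : \bar R).
  by apply/measurable_EFinP; exact: measurableT_comp.
have nuB : (\int[unif]_u (\1_B (quantile nu u))%:E = nu B)%E.
  rewrite -(pushforward_quantile nu mB).
  rewrite -[in RHS](setIT (_ @^-1` B)) -integral_indic//.
  exact: measurable_preimage.
under eq_integral do rewrite EFinD !EFinM.
rewrite ge0_integralD//; [|exact: measurable_funeM..].
rewrite !ge0_integralZl_EFin//; try by move=> u _; rewrite lee_fin.
rewrite (integral_sigma (f := fun u => \1_B (quantile nu u)))//; last first.
  exact: measurableT_comp.
rewrite nuB -ge0_muleDl ?lee_fin// -EFinD st1 mul1e//.
Qed.

Lemma rearrangement_weak_cost :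
  weak_cost_of theta mu rearrangement_kernel =
  (\int[unif]_u (theta (quantile mu u - (s%:num * quantile nu u +
      t%:num * quantile nu (sigma u))))%:E)%E.
Proof.
have mth := measurable_cost cost.
rewrite /weak_cost_of.
under eq_integral do rewrite (cost_norm cost) bary_two_point.
rewrite (integral_cdf (F := fun x u => theta (x - (s%:num * quantile nu u +
    t%:num * quantile nu (sigma u)))))//.
- apply: measurableT_comp => //; apply: measurable_funB => //.
  by apply: measurable_funD; exact: measurable_funM.
- apply: measurableT_comp => //; apply: measurable_funB => //.
  by apply: measurable_funD; exact: measurable_funM.
- by move=> x u; case: cost.
Qed.

Lemma rearrangement_classical_cost :
  classical_cost_of theta mu rearrangement_kernel =
  (\int[unif]_u (s%:num * theta (quantile mu u - quantile nu u) +
     t%:num * theta (quantile mu u - quantile nu (sigma u)))%:E)%E.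
Proof.
have mth := measurable_cost cost; have th0 x : 0 <= theta x by case: cost.
rewrite /classical_cost_of.
have E x : (\int[rearrangement_kernel x]_y (theta `|x - y|)%:E =
    (s%:num * theta (x - monge x) + t%:num * theta (x - monge_sigma x))%:E)%E.
  under eq_integral do rewrite (cost_norm cost).
  rewrite (integral_two_point _ _ _ x (h := fun y => theta (x - y)))//.
  by apply: measurableT_comp => //; exact: measurable_funB.
under eq_integral do rewrite E.
rewrite (integral_cdf (F := fun x u => s%:num * theta (x - quantile nu u) +
    t%:num * theta (x - quantile nu (sigma u))))//.
- apply: measurable_funD; apply: measurable_funM => //;
    by apply: measurableT_comp => //; exact: measurable_funB.
- apply: measurable_funD; apply: measurable_funM => //;
    by apply: measurableT_comp => //; exact: measurable_funB.
- by move=> x u; rewrite addr_ge0// mulr_ge0.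
Qed.

End quantile_rearrangement.

(** * Strict improvement where [D] decreases *)

Lemma strictly_convex_transfer (R : realType) (theta : R -> R) (x y e : R) :
  strictly_convex theta -> 0 < e -> e < x - y ->
  theta (x - e) + theta (y + e) < theta x + theta y.
Proof.
move=> sc e0 exy; have xy0 : 0 < x - y by lra.
have xNy : x != y by rewrite gt_eqF//; lra.
(* The two new points are combinations of [x] and [y] with exchanged weights, so the two strict
   inequalities add up to the claim, even if the points cross. *)
set l := e / (x - y).
have l01 : 0 < l < 1 by rewrite /l divr_gt0//= ltr_pdivrMr// mul1r.
have lxy : l * (x - y) = e by rewrite /l mulfVK// gt_eqF.
have -> : y + e = l * x + (1 - l) * y by rewrite -lxy; ring.
have -> : x - e = l * y + (1 - l) * x by rewrite -lxy; ring.
have := sc x y l xNy l01; rewrite eq_sym in xNy; have := sc y x l xNy l01.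
lra.
Qed.

Section strict_improvement.
Context {R : realType} (mu nu : probability R R) (theta : R -> R).
Hypotheses (cost : cost_function theta) (sc : strictly_convex theta).

Local Notation qmu := (quantile mu).
Local Notation qnu := (quantile nu).

(* Averaging over the involution [sigma] reduces the strict inequality between
   the integrals to the pointwise comparison of [a u + a (sigma u)] and
   [g u + g (sigma u)]. *)
Lemma lt_integral_involution (sigma a g : R -> R) (w u : R) :
  measurable_fun [set: R] sigma -> measurable_fun [set: R] a ->
  measurable_fun [set: R] g ->
  (forall A, measurable A -> unif (sigma @^-1` A) = unif A) ->
  (forall x, 0 <= a x) -> (forall x, 0 <= g x) ->
  (\int[unif]_x (a x)%:E < +oo)%E ->
  0 <= w -> w < u -> u <= 1 ->
  (forall x, 0 < x < 1 -> g x + g (sigma x) <= a x + a (sigma x)) ->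
  (forall x, w < x <= u -> g x + g (sigma x) < a x + a (sigma x)) ->
  (\int[unif]_x (g x)%:E < \int[unif]_x (a x)%:E)%E.
Proof.
move=> ms ma mg us a0 g0 a_fin w0 wu u1 le_ga lt_ga.
rewrite ltNge; apply/negP => le_ag.
have mas : measurable_fun [set: R] (fun x => a (sigma x)) by exact: measurableT_comp.
have mgs : measurable_fun [set: R] (fun x => g (sigma x)) by exact: measurableT_comp.
(* The gain, truncated because the comparison is known only on []0, 1[]. *)
pose d x : R := Num.max (a x + a (sigma x) - (g x + g (sigma x))) 0.
have d0 x : 0 <= d x by rewrite le_max lexx orbT.
have md : measurable_fun [set: R] (fun x => (d x)%:E).
  apply/measurable_EFinP/measurable_pos.
  by apply: measurable_funB; exact: measurable_funD.
have mE (f : R -> R) : measurable_fun [set: R] f ->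
  measurable_fun [set: R] (fun x => (f x)%:E) by move=> mf; exact/measurable_EFinP.
have twice (f : R -> R) : measurable_fun [set: R] f -> (forall x, 0 <= f x) ->
    (\int[unif]_x (f x + f (sigma x))%:E =
     \int[unif]_x (f x)%:E + \int[unif]_x (f x)%:E)%E.
  move=> mf f0; have mfs : measurable_fun [set: R] (fun x => f (sigma x)).
    exact: measurableT_comp.
  under eq_integral do rewrite EFinD.
  rewrite ge0_integralD//; try exact: mE.
  - by congr (_ + _)%E; exact: integral_sigma.
  - by move=> x _; rewrite lee_fin.
  - by move=> x _; rewrite lee_fin.
have g2d : (\int[unif]_x (g x + g (sigma x))%:E + \int[unif]_x (d x)%:E =
    \int[unif]_x (a x + a (sigma x))%:E)%E.
  rewrite -ge0_integralD//; last 3 first.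
  - by move=> x _; rewrite lee_fin addr_ge0.
  - by apply: mE; exact: measurable_funD.
  - by move=> x _; rewrite lee_fin.
  apply: ge0_ae_eq_integral => //.
  - by apply: emeasurable_funD => //; apply: mE; exact: measurable_funD.
  - by apply: mE; exact: measurable_funD.
  - by move=> x _; rewrite -EFinD lee_fin !addr_ge0.
  - by move=> x _; rewrite lee_fin addr_ge0.
  apply: unif_ae => x x01 _; rewrite -EFinD /d max_l ?subr_ge0 ?le_ga//.
  by rewrite addrC subrK.
rewrite !twice// in g2d.
have a_ge0 : (0 <= \int[unif]_x (a x)%:E)%E.
  by apply: integral_ge0 => x _; rewrite lee_fin.
have g_ge0 : (0 <= \int[unif]_x (g x)%:E)%E.
  by apply: integral_ge0 => x _; rewrite lee_fin.
have d_ge0 : (0 <= \int[unif]_x (d x)%:E)%E.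
  by apply: integral_ge0 => x _; rewrite lee_fin.
(* Twice the integral of [g] plus that of [d] is twice that of [a], which is finite and, by
   contradiction, at most that of [g]. *)
have int_d0 : (\int[unif]_x (d x)%:E = 0)%E.
  move: g2d le_ag a_fin a_ge0 g_ge0 d_ge0.
  move: (\int[unif]_x (a x)%:E)%E (\int[unif]_x (g x)%:E)%E (\int[unif]_x (d x)%:E)%E.
  move=> [A| |] [G| |] [D| |] //=.
  rewrite -!EFinD !lee_fin => -[EA] AG _ A0 G0 D0; congr (_%:E); lra.
have /(ae_eq_integral_abs _ measurableT md)[N [mN N0 dN]] :
    (\int[unif]_x `|(d x)%:E| = 0)%E.
  by rewrite -int_d0; apply: eq_integral => x _; rewrite gee0_abs// lee_fin.
have : (unif `]w, u]%classic <= unif N)%E.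
  have mI : measurable `]w, u]%classic by exact: measurable_itv.
  apply: le_measure; rewrite ?inE//.
  move=> x /=; rewrite in_itv/= => /lt_ga lt_x; apply: dN => /=.
  move=> /(_ I) [] /eqP; apply/negP; rewrite gt_eqF//.
  by rewrite /d lt_max subr_gt0 lt_x.
by rewrite N0 unif_itv// lee_fin ge_max lexx andbT subr_le0 leNgt wu.
Qed.

Lemma strict_improvement (u0 v0 : R) : mu `<< @lebesgue_measure R ->
  (\int[unif]_u (theta (qmu u - qnu u))%:E < +oo)%E ->
  0 < u0 -> u0 <= v0 -> v0 < 1 -> qmu v0 - qnu v0 < qmu u0 - qnu u0 ->
  exists2 p : R.-pker R ~> R, coupling_kernel mu nu p &
    (weak_cost_of theta mu p < \int[unif]_u (theta (qmu u - qnu u))%:E)%E.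
Proof.
move=> mu_leb J_fin u00 uv0 v01 Dvu.
have mth := measurable_cost cost; have th0 x : 0 <= theta x by case: cost.
have {}uv0 : u0 < v0.
  by rewrite lt_neqAle uv0 andbT; apply/eqP => uv; move: Dvu; rewrite uv ltxx.
(* A third of the gap: left continuity costs one third for [qmu] near [u0] and one for [qnu] near
   [v0], so a gap of at least [eta] remains. *)
pose eta := (qmu u0 - qnu u0 - (qmu v0 - qnu v0)) / 3.
have eta0 : 0 < eta by rewrite /eta divr_gt0// subr_gt0.
have u001 : 0 < u0 < 1 by lra.
have v001 : 0 < v0 < 1 by lra.
have [w1 /andP[w10 w1u] Hw1] := cdf_inv_left mu u001 eta0.
have [w2 /andP[w20 w2u] Hw2] := cdf_inv_left nu u001 eta0.
have [w3 /andP[w30 w3v] Hw3] := cdf_inv_left nu v001 eta0.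
pose h := v0 - u0.
(* The first three bounds put []w, u0]] and its translate by [h] where the left continuity estimates
   hold; the last makes these intervals disjoint. *)
pose w := Num.max (Num.max w1 w2) (Num.max (w3 - h) (u0 - h)).
have ww1 : w1 <= w by rewrite /w !le_max lexx.
have ww2 : w2 <= w by rewrite /w !le_max lexx orbT.
have ww3 : w3 - h <= w by rewrite /w !le_max lexx !orbT.
have ww4 : u0 - h <= w by rewrite /w !le_max lexx !orbT.
have wu : w < u0 by rewrite /w !gt_max w1u w2u/= /h; apply/andP; split; lra.
have w0 : 0 <= w by lra.
have uwv : u0 <= w + (v0 - u0) by rewrite /h in ww4; lra.
clearbody w.
pose M := qnu v0 - qnu u0 + eta.
have qnd (m : probability R R) := @quantile_nd01 R m.
have etaM : eta <= M by rewrite /M lerDr subr_ge0 qnd// ltW.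
have M0 : 0 < M by lra.
(* [M] bounds [qnu y - qnu x] on exchanged pairs, so exchanging the fraction [T] shifts the values
   of [D] by at most [eta / 2], less than the remaining gap. *)
pose T : R := eta / (2 * M).
have T0 : 0 <= T by rewrite /T divr_ge0// ?ltW//; lra.
have T1 : 0 <= 1 - T.
  by rewrite subr_ge0 /T ler_pdivrMr ?mul1r; lra.
have T_gt0 : 0 < T by rewrite /T divr_gt0//; lra.
have TM : T * M < eta.
  have -> : T * M = eta / 2 by rewrite /T; field; rewrite gt_eqF.
  by lra.
pose t := NngNum T0; pose s := NngNum T1.
have st1 : s%:num + t%:num = 1 by rewrite /= subrK.
pose sigma := swap w u0 v0.
have msigma : measurable_fun [set: R] sigma by exact: measurable_swap.
have usigma A : measurable A -> unif (sigma @^-1` A) = unif A.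
  exact: unif_swap.
exists (rearrangement_kernel mu nu st1 msigma).
  exact: rearrangement_coupling.
rewrite rearrangement_weak_cost//.
have mqmu := measurable_quantile mu; have mqnu := measurable_quantile nu.
pose g u := theta (qmu u - (s%:num * qnu u + t%:num * qnu (sigma u))).
pose a u := theta (qmu u - qnu u).
have mqnus : measurable_fun [set: R] (fun u => qnu (sigma u)).
  exact: measurableT_comp.
have lt_ga x : w < x <= u0 -> g x + g (sigma x) < a x + a (sigma x).
  move=> /andP[wx xu]; have sx : sigma x = x + (v0 - u0).
    by rewrite /sigma /swap wx xu.
  have ssx : sigma (x + (v0 - u0)) = x by rewrite -sx /sigma swapK.
  rewrite /g /a sx ssx /=; set y := x + (v0 - u0).
  have x01 : 0 < x < 1 by lra.
  have y01 : 0 < y < 1 by rewrite /y; lra.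
  have x1 : qmu u0 - eta <= qmu x by rewrite !quantileE//; apply: Hw1 => //; lra.
  have x2 : qnu u0 - eta <= qnu x by rewrite !quantileE//; apply: Hw2 => //; lra.
  have y2 : qnu v0 - eta <= qnu y.
    by rewrite !quantileE//; apply: Hw3; rewrite /y; rewrite /h in ww3; lra.
  have x3 : qnu x <= qnu u0 by apply: qnd; lra.
  have y3 : qnu y <= qnu v0 by apply: qnd; rewrite /y; lra.
  have y1 : qmu y <= qmu v0 by apply: qnd; rewrite /y; lra.
  have xy : qmu x <= qmu y by apply: qnd; rewrite /y; lra.
  have eta3 : 3 * eta = qmu u0 - qnu u0 - (qmu v0 - qnu v0).
    by rewrite /eta; field.
  pose e := T * (qnu y - qnu x).
  (* The gap in [D] is at least [eta] while [qmu] does not decrease from [x] to [y], so [qnu] must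
     rise by [eta]; the shift [e] is thus positive. *)
  have Delta0 : eta <= qnu y - qnu x by lra.
  have DeltaM : qnu y - qnu x <= M by rewrite /M; lra.
  have e0 : 0 < e by rewrite /e mulr_gt0//; lra.
  have eE : e < (qmu x - qnu x) - (qmu y - qnu y).
    apply: (@lt_le_trans _ _ eta); last by lra.
    by apply: le_lt_trans TM; rewrite /e ler_wpM2l.
  have -> : qmu x - ((1 - T) * qnu x + T * qnu y) = qmu x - qnu x - e.
    by rewrite /e; ring.
  have -> : qmu y - ((1 - T) * qnu y + T * qnu x) = qmu y - qnu y + e.
    by rewrite /e; ring.
  exact: strictly_convex_transfer.
apply: (@lt_integral_involution sigma a g w u0) => //.
- by apply: measurableT_comp => //; exact: measurable_funB.
- apply: measurableT_comp => //; apply: measurable_funB => //.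
  by apply: measurable_funD; exact: measurable_funM.
- by move=> x; exact: th0.
- by move=> x; exact: th0.
- exact: le_trans (ltW uv0) (ltW v01).
move=> x x01; have [x1|x1] := boolP (w < x <= u0); first exact/ltW/lt_ga.
(* On the upper interval the pair [x], [sigma x] is one already treated from the lower interval;
   elsewhere [sigma] fixes [x] and nothing changes. *)
have [x2|x2] := boolP (w + (v0 - u0) < x <= v0).
  have sx : sigma x = x - (v0 - u0) by rewrite /sigma /swap (negbTE x1) x2.
  have ssx : sigma (x - (v0 - u0)) = x by rewrite -sx /sigma swapK.
  have := @lt_ga (x - (v0 - u0)); rewrite ssx sx => /(_ _)/ltW h1.
  by rewrite addrC [leRHS]addrC h1//; lra.
have sx : sigma x = x by rewrite /sigma /swap (negbTE x1) (negbTE x2).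
rewrite sx.
suff -> : g x = a x by [].
by rewrite /g /a sx -mulrDl st1 mul1r.
Qed.

End strict_improvement.

(** * Both optimal costs against the cost [J] of the quantile coupling *)

Theorem theorem2p2 (R : realType) (mu nu : probability R R) (theta : R -> R) :
  finite_first_moment mu -> finite_first_moment nu ->
  mu `<< (@lebesgue_measure R) -> nu `<< (@lebesgue_measure R) ->
  cost_function theta -> strictly_convex theta ->
  (exists p : R.-pker R ~> R,
      coupling_kernel mu nu p /\ (weak_cost_of theta mu p < +oo)%E) ->
  (weak_transport_cost theta mu nu = transport_cost theta mu nu <->
   (forall u v : R, 0 < u -> u <= v -> v < 1 ->
      cdf_inv mu u - cdf_inv nu u <= cdf_inv mu v - cdf_inv nu v)).
Proof.
move=> _ nu_fin mu_leb _ cost sc [p0 [mu_p0_nu p0_fin]].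
pose D u := quantile mu u - quantile nu u.
pose J := (\int[unif]_u (theta (D u))%:E)%E.
have st1 : (0%:nng : {nonneg R})%:num + (1%:nng : {nonneg R})%:num = 1 :> R.
  by rewrite /= add0r.
have mid : measurable_fun [set: R] (fun u : R => u) by exact: measurable_id.
have uid A : measurable A -> unif ((fun u : R => u) @^-1` A) = unif A by [].
(* With weights [0] and [1] and the identity as rearrangement, this is the deterministic kernel of
   the monotone map. *)
pose q := rearrangement_kernel mu nu st1 mid.
have mu_q_nu : coupling_kernel mu nu q by exact: rearrangement_coupling.
have q_weak : weak_cost_of theta mu q = J.
  rewrite rearrangement_weak_cost//; apply: eq_integral => u _ /=.
  by rewrite mul0r mul1r add0r.
have q_classical : classical_cost_of theta mu q = J.
  rewrite rearrangement_classical_cost//; apply: eq_integral => u _ /=.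
  by rewrite mul0r mul1r add0r.
have transportE : transport_cost theta mu nu = J.
  apply/eqP; rewrite eq_le; apply/andP; split.
    by apply: ereal_inf_lbound; exists q.
  by apply: le_ereal_inf_tmp => _ [p [mu_p_nu ->]]; exact: classical_cost_ge.
have weak_le : (weak_transport_cost theta mu nu <= J)%E.
  by apply: ereal_inf_lbound; exists q.
have DE u : 0 < u < 1 -> D u = cdf_inv mu u - cdf_inv nu u.
  by move=> u01; rewrite /D !quantileE.
rewrite transportE; split => [weakE u v u0 uv v1|D_nd].
- have u01 : 0 < u < 1 by rewrite u0 (le_lt_trans uv).
  have v01 : 0 < v < 1 by rewrite v1 (lt_le_trans u0).
  rewrite -!DE// leNgt; apply/negP => Dvu.
  (* Equality of the costs transfers the finiteness given by [p0] to [J], as the strict improvement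
     requires. *)
  have J_fin : (J < +oo)%E.
    rewrite -weakE; apply: le_lt_trans p0_fin.
    by apply: ereal_inf_lbound; exists p0.
  have [p mu_p_nu] := strict_improvement cost sc mu_leb J_fin u0 uv v1 Dvu.
  apply/negP; rewrite -leNgt -/J -weakE.
  by apply: ereal_inf_lbound; exists p.
- apply/eqP; rewrite eq_le weak_le/=.
  apply: le_ereal_inf_tmp => _ [p [mu_p_nu ->]]; apply: weak_cost_ge => //.
  move=> u v u0 uv v1; rewrite -/(D u) -/(D v) !DE ?D_nd//.
    by rewrite v1 (lt_le_trans u0).
  by rewrite u0 (le_lt_trans uv).
Qed.
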